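(* Let $(w_n)_{n\ge 1}$ be a sequence of integers with $w_n>1$ for all $n$, and let $\Theta$ be the solenoid of type $\varpi=(w_1,w_2,\dots,w_n,\dots)$. Then for every surface $F$ there is no topological embedding $\Theta\to F$ (that is, no map $\Theta\to F$ that is a homeomorphism onto its image with the subspace topology).
   Context: Let $S^1=\{z\in\mathbb{C} : |z|=1\}$. Given a sequence of integers $\varpi=(w_1,w_2,\dots,w_n,\dots)$ with every $w_n>1$, let $\phi_n:S^1\to S^1$ be $\phi_n(x)=x^{w_n}$ for $n\ge 1$. The solenoid of type $\varpi$ is the inverse limit $$\Theta=\{(x_0,x_1,\dots,x_n,\dots) : x_n\in S^1 \text{ for } n\ge 0,\ x_{n-1}=\phi_n(x_n) \text{ for } n\ge 1\}\subset\prod_{n=0}^\infty S^1,$$ with the subspace topology of the product topology. (By convention the circle itself is not considered a solenoid; this is reflected in the requirement $w_n>1$.) A surface is a 2-dimensional topological manifold; it is not assumed to be compact or orientable. *)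

(* Defs.v *)
From HB Require Import structures.
From mathcomp Require Import all_boot all_order all_algebra.
From mathcomp Require Import all_classical all_reals all_analysis.
From mathcomp Require Import complex.

Set Implicit Arguments.
Unset Strict Implicit.
Unset Printing Implicit Defensive.

Import Order.TTheory GRing.Theory Num.Theory.
Import numFieldNormedType.Exports.

Local Open Scope classical_set_scope.
Local Open Scope ring_scope.

(* Throughout, a set [A] used as a type carries the subspace topology. *)

Definition homeomorphism (X Y : topologicalType) (f : X -> Y) : Prop :=
  continuous f /\
  exists g : Y -> X, [/\ cancel f g, cancel g f & continuous g].

Definition to_range (X Y : Type) (f : X -> Y) (x : X) : range f :=
  exist _ (f x) (mem_set (imageT f x)).

Definition embedding (X Y : topologicalType) (f : X -> Y) : Prop :=
  homeomorphism (to_range f).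

Definition surface (R : realType) (F : topologicalType) : Prop :=
  [/\ hausdorff_space F, @second_countable F &
    forall p : F, exists (U : set F) (V : set (R * R)) (h : U -> V),
      [/\ open U, U p, open V & homeomorphism h]].

(* The regular-algebra alias [R[i]^o] is what carries the topology of the
   modulus on the complex numbers. *)
Definition circle (R : realType) : set R[i]^o :=
  [set z | `|z : R[i]| = 1].

Arguments circle R : clear implicits.

Lemma circle_exp (R : realType) (k : nat) (z : circle R) :
  circle R (set_val z ^+ k).
Proof. by have z1 := set_valP z; rewrite /circle /= normrX z1 expr1n. Qed.

Definition circle_pow (R : realType) (k : nat) (z : circle R) : circle R :=
  exist _ (set_val z ^+ k) (mem_set (circle_exp k z)).

(* [w 0] plays no role: the bonding maps are indexed from 1. *)
Definition solenoid (R : realType) (w : nat -> nat) :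
    set (prod_topology (fun _ : nat => circle R)) :=
  [set x | forall n : nat, (1 <= n)%N -> x n.-1 = circle_pow (w n) (x n)].

Arguments solenoid R w : clear implicits.

(* Main.v *)
(* Let phi_t be the flow on the solenoid that multiplies the n-th coordinate by
   exp (2 i pi t / W_n), where W_n = w_1 ... w_n; the times W_n are almost
   periods: m W_n moves every point little, uniformly in the integer m.  Suppose
   that f embeds the solenoid in a surface.

   For x, x' close together on different local flow lines, read in a chart the
   vector f (phi_t x') - f (phi_s x) as (s, t) goes from (- e, e) to (e, - e).
   Its direction is nearly reversed, so it turns by an angle close to an odd
   multiple of pi, which tells on which "side" of x the point x' lies; exchanging
   x and x' negates that multiple.  Whether x' and x'' lie on the same side of x
   depends neither on the chart (not even on its orientation) nor on e, so by
   compactness it is preserved by the flow as soon as x' and x'' are obtained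
   from x by the flow at nonzero multiples of a large W_n.

   The image of f contains no disc, hence there is a small disc in a chart whose
   closure meets it in one boundary point f x0 only.  All points near x0 then lie
   on the same side of x0.  Flowing from x0 to x1 = phi_(W_n) x0 and to
   x2 = phi_(2 W_n) x0, each of x0, x1, x2 has the other two on the same side,
   which is impossible: by antisymmetry the common multiple of pi would be 0. *)
Require Import Defs.
From HB Require Import structures.
From mathcomp Require Import all_boot all_order all_algebra.
From mathcomp Require Import all_classical all_reals all_analysis.
From mathcomp Require Import complex.
From mathcomp Require Import ring lra.

Set Implicit Arguments.
Unset Strict Implicit.
Unset Printing Implicit Defensive.

Import Order.TTheory GRing.Theory Num.Theory.
Import numFieldNormedType.Exports.

Local Open Scope classical_set_scope.
Local Open Scope ring_scope.

(** * Angles of plane vectors *)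

Section Angles.
Variable R : realType.
Implicit Types (u v : R * R) (t : R).

(** The embedding and the charts are only continuous, so an arc has no tangent, and a nonorientable
    surface may reverse orientation along the flow. Hence no side is ever named: [same_side] only
    compares the chords from [x] to two companions. It extracts no integer either, but asks for
    lifts of the angle that agree within a quarter turn at both ends, so that every comparison
    reduces to homotopies through nonzero vectors. The order of choices matters: reaching phi_(W_n)
    x0 takes a number of small flow steps that grows with [n], so charts, neighbourhoods and step
    length are fixed by compactness before [n]. Uniformity of the almost periods in m makes this
    possible: the companions follow the base point during the whole walk, which also ends near its
    start. *)

Definition dot u v : R := u.1 * v.1 + u.2 * v.2.

Definition crs u v : R := u.1 * v.2 - u.2 * v.1.

Definition len v : R := Num.sqrt (dot v v).

Definition polar (r t : R) : R * R := (r * cos t, r * sin t).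

(** A relation, because [t] is determined only modulo a full turn and continuous choices of it will
    wind. *)
Definition angle t v := 0 < len v /\ v = polar (len v) t.

Lemma dotvv_ge0 v : 0 <= dot v v.
Proof. by rewrite /dot; nra. Qed.

Lemma len_ge0 v : 0 <= len v.
Proof. exact: sqrtr_ge0. Qed.

Lemma len2 v : len v ^+ 2 = dot v v.
Proof. by rewrite sqr_sqrtr// dotvv_ge0. Qed.

Lemma len_gt0 v : (0 < len v) = (v != 0).
Proof.
rewrite sqrtr_gt0 lt_def dotvv_ge0 andbT; congr (~~ _).
apply/eqP/eqP => [h|->]; last by rewrite /dot/=; ring.
case: v h => a b; rewrite /dot/= => h.
have -> : a = 0 by nra.
by have -> : b = 0 by nra.
Qed.

Lemma len_polar r t : 0 <= r -> len (polar r t) = r.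
Proof.
move=> r0; rewrite /len /dot /polar/=.
have -> : r * cos t * (r * cos t) + r * sin t * (r * sin t) = r ^+ 2.
  by rewrite -[RHS]mulr1 -(cos2Dsin2 t); ring.
by rewrite sqrtr_sqr ger0_norm.
Qed.

Lemma angle_polar r t : 0 < r -> angle t (polar r t).
Proof. by move=> r0; rewrite /angle len_polar// ltW. Qed.

Lemma angle_dot t t' u v : angle t u -> angle t' v ->
  dot u v = len u * len v * cos (t - t').
Proof.
move=> [_ {1}->] [_ {1}->]; rewrite /dot /polar/= cosB; ring.
Qed.

Lemma angle_dot_gt0 t t' u v : angle t u -> angle t' v ->
  (0 < dot u v) = (0 < cos (t - t')).
Proof.
move=> tu tv; rewrite (angle_dot tu tv) pmulr_rgt0//.
by case: tu => ? _; case: tv => ? _; apply: mulr_gt0.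
Qed.

Lemma angle_unique t t' v : angle t v -> angle t' v -> cos (t - t') = 1.
Proof.
move=> tv tv'; have := angle_dot tv tv'; case: tv => v0 _.
rewrite -len2 -expr2 => /esym; rewrite -[RHS]mulr1.
by move/mulfI; apply; rewrite expf_neq0// gt_eqF.
Qed.

Lemma angle_shift c t v : cos c = 1 -> angle t v -> angle (t - c) v.
Proof.
move=> c1 [v0 tv]; split=> //; rewrite [LHS]tv /polar.
have s0 : sin c = 0 by apply: cos1sin0; rewrite c1 normr1.
by rewrite cosB sinB c1 s0 !mulr1 !mulr0 subr0 addr0.
Qed.

Lemma angle_pi t v : angle t v -> angle (t + pi) (- v).
Proof.
move=> [v0 tv]; have lv : len (- v) = len v.
  by rewrite /len /dot/= !mulrNN.
split; rewrite lv// {1}tv /polar cosDpi sinDpi.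
by rewrite !mulrN.
Qed.

(** The quotient is the tangent of the angle from [u] to [v], and positivity of [dot u v] puts that
    angle where [atan] inverts [tan]. The increment is an explicit continuous function of the two
    vectors, from which all lifts are built. *)
Lemma angle_step t u v : angle t u -> 0 < dot u v ->
  angle (t + atan (crs u v / dot u v)) v.
Proof.
move=> [u0 tu] uv.
set q := crs u v / dot u v.
have cq0 : 0 < cos (atan q).
  by apply: cos_gt0_pihalf; rewrite atan_gtNpi2 atan_ltpi2.
have sq : sin (atan q) = q * cos (atan q).
  by rewrite -{2}(atanK q) /tan divfK// gt_eqF.
have hv : v = polar (dot u v / (len u * cos (atan q))) (t + atan q).
  have ne1 : len u != 0 by rewrite gt_eqF.
  have ne2 : cos (atan q) != 0 by rewrite gt_eqF.
  have ne3 : dot u v != 0 by rewrite gt_eqF.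
  rewrite /polar cosD sinD sq.
  have -> : dot u v / (len u * cos (atan q)) *
      (cos t * cos (atan q) - sin t * (q * cos (atan q))) =
      (dot u v * cos t - crs u v * sin t) / len u by rewrite /q; field; exact/and3P.
  have -> : dot u v / (len u * cos (atan q)) *
      (sin t * cos (atan q) + cos t * (q * cos (atan q))) =
      (dot u v * sin t + crs u v * cos t) / len u by rewrite /q; field; exact/and3P.
  have E1 : u.1 = len u * cos t by rewrite {1}tu.
  have E2 : u.2 = len u * sin t by rewrite {1}tu.
  have cs := cos2Dsin2 t.
  case: v {uv q cq0 sq ne2 ne3} => a b; rewrite /dot /crs/= E1 E2; congr (_, _).
    transitivity (a * (cos t ^+ 2 + sin t ^+ 2)); first by rewrite cs mulr1.
    by field.
  transitivity (b * (cos t ^+ 2 + sin t ^+ 2)); first by rewrite cs mulr1.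
  by field.
rewrite [X in angle _ X]hv; apply: angle_polar.
by rewrite divr_gt0// mulr_gt0.
Qed.

Lemma angle_exists v : v != 0 -> exists t, angle t v.
Proof.
move=> v0.
(* One of the four axis directions makes an acute angle with [v]. *)
have [u [t [tu uv]]] : exists u t, angle t u /\ 0 < dot u v.
  have P t : angle t (polar 1 t) by exact: angle_polar.
  case: (ltrgt0P v.1) => v1.
  - exists (polar 1 0), 0; split=> //.
    by rewrite /dot /polar/= cos0 sin0; lra.
  - exists (polar 1 pi), pi; split=> //.
    by rewrite /dot /polar/= cospi sinpi; lra.
  case: (ltrgt0P v.2) => v2.
  - exists (polar 1 (pi / 2)), (pi / 2); split=> //.
    by rewrite /dot /polar/= cos_pihalf sin_pihalf; lra.
  - exists (polar 1 (- (pi / 2))), (- (pi / 2)); split=> //.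
    by rewrite /dot /polar/= cosN sinN cos_pihalf sin_pihalf; lra.
  by case: v v0 v1 v2 => a b /= /eqP + a0 b0; rewrite a0 b0.
by exists (t + atan (crs u v / dot u v)); exact: angle_step.
Qed.

Lemma cos_lt1 t : 0 < `|t| <= pi -> cos t < 1.
Proof.
move=> /andP[t0 tpi]; rewrite -cos0 -(cos_norm t) ltr_cos// in_itv/=.
  by rewrite lexx pi_ge0.
by rewrite normr_ge0.
Qed.

Lemma ivt_norm (h : R -> R) (c : R) : continuous h ->
  `|h 0| < c -> c <= `|h 1| -> exists2 s, s \in `[0, 1]%R & `|h s| = c.
Proof.
move=> ch h0 h1; apply: (@IVT R (fun s => `|h s|) 0 1 c) => //.
  apply: continuous_subspaceT => s.
  by apply: continuous_comp; [exact: ch|exact: norm_continuous].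
have h01 : `|h 0| <= `|h 1| by exact: le_trans (ltW h0) h1.
by rewrite (min_idPl h01) (max_idPr h01) h1 ltW.
Qed.

Lemma close_end (h : R -> R) : continuous h ->
  (forall s, s \in `[0, 1]%R -> 0 < cos (h s)) ->
  `|h 0| < pi / 2 -> `|h 1| < pi / 2.
Proof.
move=> ch hc h0; rewrite ltNge; apply/negP => h1.
have [s s01 hs] := ivt_norm ch h0 h1.
by have := hc s s01; rewrite -cos_norm hs cos_pihalf ltxx.
Qed.

Lemma const_end (h : R -> R) : continuous h ->
  (forall s, s \in `[0, 1]%R -> cos (h s) = 1) -> h 0 = 0 -> h 1 = 0.
Proof.
move=> ch hc h0; apply/eqP; rewrite -normr_eq0; apply/negPn/negP => h1.
have h1' : 0 < `|h 1| by rewrite lt_def h1 normr_ge0.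
(* Capping at [pi] keeps the value that is reached in the range of [cos_lt1]. *)
have m0 : 0 < Num.min `|h 1| pi by rewrite lt_min h1' pi_gt0.
have [||s s01 hs] := @ivt_norm h (Num.min `|h 1| pi) ch.
- by rewrite h0 normr0.
- by rewrite ge_min lexx.
have := hc s s01; have := @cos_lt1 (h s).
by rewrite hs m0 ge_min lexx orbT => /(_ isT) /lt_eqF/eqP.
Qed.

End Angles.

(** * Continuous choice of the angle over a square *)

Section Lift.
Variable R : realType.

Lemma cvg_pr (T : Type) (A B : topologicalType) (F : set_system T)
    (FF : Filter F) (f : T -> A) (g : T -> B) (a : A) (b : B) :
  f x @[x --> F] --> a -> g x @[x --> F] --> b ->
  (f x, g x) @[x --> F] --> ((a, b) : A * B).
Proof. exact: (@cvg_pair _ _ _ F (nbhs a) (nbhs b)). Qed.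

Lemma cvg_fst_of (T : Type) (F : set_system T) (FF : Filter F) (f : T -> R * R)
    (u : R * R) : f x @[x --> F] --> u -> (f x).1 @[x --> F] --> u.1.
Proof. by move=> fu; apply: cvg_comp fu _; exact: cvg_fst. Qed.

Lemma cvg_snd_of (T : Type) (F : set_system T) (FF : Filter F) (f : T -> R * R)
    (u : R * R) : f x @[x --> F] --> u -> (f x).2 @[x --> F] --> u.2.
Proof. by move=> fu; apply: cvg_comp fu _; exact: cvg_snd. Qed.

Lemma cvg_dot (T : Type) (F : set_system T) (FF : Filter F)
    (f g : T -> R * R) (u v : R * R) :
  f x @[x --> F] --> u -> g x @[x --> F] --> v ->
  dot (f x) (g x) @[x --> F] --> dot u v.
Proof.
by move=> fu gv; apply: cvgD; apply: cvgM;
  do ?[exact: cvg_fst_of|exact: cvg_snd_of].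
Qed.

Lemma cvg_crs (T : Type) (F : set_system T) (FF : Filter F)
    (f g : T -> R * R) (u v : R * R) :
  f x @[x --> F] --> u -> g x @[x --> F] --> v ->
  crs (f x) (g x) @[x --> F] --> crs u v.
Proof.
by move=> fu gv; apply: cvgB; apply: cvgM;
  do ?[exact: cvg_fst_of|exact: cvg_snd_of].
Qed.

Lemma dot_gt0_near (v : R * R) : v != 0 ->
  \forall a \near v & b \near v, 0 < dot a b.
Proof.
move=> v0.
have : dot p.1 p.2 @[p --> (v, v)] --> dot v v.
  by apply: cvg_dot; [exact: cvg_fst|exact: cvg_snd].
by move/cvgr_gt; apply; rewrite -len2 exprn_gt0// len_gt0.
Qed.

(** The form of uniform continuity that lifting needs, by a Lebesgue number argument: over a
    distance less than [d] the vector turns by less than a right angle. *)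
Lemma unif_dot (V : R * R -> R * R) (K : set (R * R)) : compact K ->
  (forall p, K p -> {for p, continuous V}) -> (forall p, K p -> V p != 0) ->
  exists2 d : R, 0 < d &
    forall p q, K p -> `|p - q| < d -> 0 < dot (V p) (V q).
Proof.
move=> /compact_near_coveringP cK Vc V0.
pose P (d : R) p := forall q, `|p - q| < d -> 0 < dot (V p) (V q).
have : \forall d \near 0^'+, K `<=` P d.
  apply: cK => p Kp.
  have [[A B] /= [Ap Bp] AB] := dot_gt0_near (V0 p Kp).
  have : nbhs p [set q | A (V q) /\ B (V q)].
    by apply: filterI; apply: (Vc p Kp).
  move=> /nbhs_ballP[e /= e0 be].
  near=> q d.
  have pq : `|p - q| < e / 2.
    by near: q; apply: cvgr_dist_lt => //; rewrite divr_gt0.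
  have de : d <= e / 2 by near: d; apply: nbhs_right_le; rewrite divr_gt0.
  move=> r qr; apply: (AB (V q, V r)); split.
    by apply: (be q _).1; rewrite -ball_normE /= (lt_trans pq)// ltr_pdivrMr//; lra.
  apply: (be r _).2; rewrite -ball_normE /=.
  rewrite (splitr e) (le_lt_trans (ler_distD q _ _))// ltrD//.
  exact: lt_le_trans qr de.
move=> H; have [d [dK d0]] : exists d : R, K `<=` P d /\ 0 < d.
  apply: (@filter_ex _ (0^'+)); apply: filterI => //; exact: nbhs_right_gt.
by exists d => // p q /dK; apply.
Unshelve. all: by end_near. Qed.

(** Retracts the line onto the unit interval, so that lifts are continuous on the whole plane
    although [V] is controlled on the square only. *)
Definition clamp (x : R) : R := Num.max 0 (Num.min x 1).

Lemma clamp_continuous : continuous clamp.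
Proof.
move=> x; rewrite /clamp.
under eq_fun do rewrite maxr_absE minr_absE.
have cmin : (y + 1 - `|y - 1|) / 2 @[y --> x] --> (x + 1 - `|x - 1|) / 2.
  apply: cvgMl; apply: cvgB; first by apply: cvgD; [exact: cvg_id|exact: cvg_cst].
  by apply: cvg_norm; apply: cvgB; [exact: cvg_id|exact: cvg_cst].
apply: cvgMl; apply: cvgD; first by apply: cvgD => //; exact: cvg_cst.
by apply: cvg_norm; apply: cvgB => //; exact: cvg_cst.
Qed.

Lemma clamp_in (x : R) : 0 <= clamp x <= 1.
Proof. by rewrite /clamp le_max lexx/= ge_max ler01 ge_min lexx orbT. Qed.

Lemma clamp_id (x : R) : 0 <= x <= 1 -> clamp x = x.
Proof. by move=> /andP[x0 x1]; rewrite /clamp (min_idPl x1) (max_idPr x0). Qed.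

Definition usquare : set (R * R) := `[0, 1] `*` `[0, 1].

Lemma usquareP (p : R * R) : usquare p <-> (0 <= p.1 <= 1) /\ (0 <= p.2 <= 1).
Proof. by rewrite /usquare /= !in_itv. Qed.

Lemma usquare_compact : compact usquare.
Proof. by apply: compact_setX; exact: segment_compact. Qed.

(** The square is star-shaped about its corner 0: the angle is propagated from there by dilating the
    square in [N] steps, each too short for [V] to turn by a right angle. *)
Lemma rect_lift (V : R * R -> R * R) :
  (forall p, usquare p -> {for p, continuous V}) ->
  (forall p, usquare p -> V p != 0) ->
  exists2 psi : R * R -> R, continuous psi &
    forall p, usquare p -> angle (psi p) (V p).
Proof.
move=> Vc V0.
have [d d0 dV] := unif_dot usquare_compact Vc V0.
pose c (p : R * R) := (clamp p.1, clamp p.2).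
have cc : continuous c.
  move=> p; apply: cvg_pr.
    apply: (cvg_comp fst clamp); [exact: cvg_fst|exact: clamp_continuous].
  apply: (cvg_comp snd clamp); [exact: cvg_snd|exact: clamp_continuous].
have cu p : usquare (c p) by apply/usquareP; rewrite !clamp_in.
have cid p : usquare p -> c p = p.
  by case: p => a b /usquareP/= [a1 b1]; rewrite /c /= !clamp_id.
have [n nd] : exists n : nat, n.+1%:R^-1 < d.
  exists (Num.truncn d^-1); rewrite -[ltRHS]invrK ltf_pV2 ?posrE ?invr_gt0//.
  exact: truncnS_gt.
set N : R := n.+1%:R in nd.
have N0 : 0 < N by rewrite ltr0n.
have su (k : nat) p : (k <= n.+1)%N -> usquare ((k%:R / N) *: c p).
  move=> kn; have /usquareP[c1 c2] := cu p.
  have k01 : 0 <= k%:R / N <= 1.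
    by rewrite divr_ge0 ?(ltW N0)//= ler_pdivrMr// mul1r ler_nat.
  have mul01 (a x : R) : 0 <= a <= 1 -> 0 <= x <= 1 -> 0 <= a * x <= 1.
    by move=> /andP[a0 a1] /andP[x0 x1]; rewrite mulr_ge0//= mulr_ile1.
  by apply/usquareP; split; exact: mul01.
have step (k : nat) : (k <= n.+1)%N -> exists2 psi : R * R -> R, continuous psi &
    forall p, angle (psi p) (V ((k%:R / N) *: c p)).
  elim: k => [_|k IH kn].
    have [t th] : exists t, angle t (V 0).
      by apply/angle_exists/V0; apply/usquareP; rewrite /= lexx ler01.
    exists (fun _ => t); first by move=> p; exact: cvg_cst.
    by move=> p; rewrite mul0r scale0r.
  have [psi pc pa] := IH (ltnW kn).
  have dp p : 0 < dot (V ((k%:R / N) *: c p)) (V ((k.+1%:R / N) *: c p)).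
    apply: dV; first exact: su (ltnW kn).
    rewrite -scalerBl -mulrBl -natr1 opprD addrA subrr add0r mulN1r scaleNr.
    rewrite normrN normrZ gtr0_norm ?invr_gt0//.
    apply: le_lt_trans nd; rewrite -[leRHS]mulr1 ler_pM2l ?invr_gt0//.
    have /usquareP[/andP[? ?] /andP[? ?]] := cu p.
    by rewrite prod_normE /= ge_max !ger0_norm// ; apply/andP; split.
  exists (fun p => psi p + atan (crs (V ((k%:R / N) *: c p)) (V ((k.+1%:R / N) *: c p))
       / dot (V ((k%:R / N) *: c p)) (V ((k.+1%:R / N) *: c p)))); last first.
    by move=> p; apply: angle_step.
  move=> p.
  have cV (j : nat) : (j <= n.+1)%N ->
      V ((j%:R / N) *: c q) @[q --> p] --> V ((j%:R / N) *: c p).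
    move=> jn; apply: (@cvg_comp _ _ _ (fun q => (j%:R / N) *: c q) V).
      by apply: cvgZr; exact: cc.
    exact: Vc (su _ _ jn).
  apply: cvgD; first exact: pc.
  apply: (@cvg_comp _ _ _ _ atan _ _ _ _ (@continuous_atan _ _)).
  apply: cvgM; first by apply: cvg_crs; apply: cV => //; exact: ltnW.
  apply: cvgV; first by rewrite gt_eqF.
  by apply: cvg_dot; apply: cV => //; exact: ltnW.
have [psi pc pa] := step n.+1 (leqnn _).
exists psi => // p pu.
by have := pa p; rewrite divff ?gt_eqF// scale1r cid.
Qed.

End Lift.

(** * Rotation of plane paths *)

Section Rotation.
Variable R : realType.
Implicit Types (g h u v : R -> R * R) (t : R -> R).

Definition lift t g :=
  continuous t /\ forall s, 0 <= s <= 1 -> angle (t s) (g s).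

Definition nonvanishing g :=
  forall s, 0 <= s <= 1 -> {for s, continuous g} /\ g s != 0.

(** A quarter turn at each end leaves the total rotations less than [pi] apart. This replaces an
    equality of integers when the end vectors of [g] and [h] are close but different. *)
Definition same_rotation g h := exists t t', [/\ lift t g, lift t' h,
  `|t 0 - t' 0| < pi / 2 & `|t 1 - t' 1| < pi / 2].

Lemma path_lift g : nonvanishing g -> exists t, lift t g.
Proof.
move=> gc.
have [p /usquareP[/gc[pc _] _]|p /usquareP[/gc[]//]|psi psic psia] :=
    @rect_lift _ (g \o fst).
  by apply: (cvg_comp fst g); [exact: cvg_fst|exact: pc].
exists (fun s => psi (s, 0)); split.
  move=> s; apply: (cvg_comp (fun s => (s, 0)) psi); last exact: psic.
  by apply: cvg_pr; [exact: cvg_id|exact: cvg_cst].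
by move=> s s01; apply: (psia (s, 0)); apply/usquareP; rewrite /= lexx ler01.
Qed.

Lemma lift_shift t g c : cos c = 1 -> lift t g -> lift (fun s => t s - c) g.
Proof.
move=> c1 [tc ta]; split; last by move=> s /ta; exact: angle_shift.
by move=> s; apply: cvgB; [exact: tc|exact: cvg_cst].
Qed.

Lemma lift_var t t' g : lift t g -> lift t' g -> t 1 - t 0 = t' 1 - t' 0.
Proof.
move=> tg tg'.
have c1 : cos (t 0 - t' 0) = 1.
  by apply: angle_unique (tg.2 _ _) (tg'.2 _ _); rewrite lexx ler01.
have [uc ua] := lift_shift c1 tg.
have := @const_end _ (fun s => t s - (t 0 - t' 0) - t' s).
move=> H; suff : t 1 - (t 0 - t' 0) - t' 1 = 0 by lra.
apply: H; last by ring.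
  by move=> s; apply: cvgB; [exact: uc|exact: tg'.1].
by move=> s; rewrite in_itv/= => s01; exact: angle_unique (ua _ s01) (tg'.2 _ s01).
Qed.

(** Reversed time with negated vectors is what a path of chords becomes when its two arcs are
    swapped; the total rotation changes sign. *)
Lemma lift_rev t g : lift t g -> lift (fun s => t (1 - s) + pi) (fun s => - g (1 - s)).
Proof.
move=> [tc ta]; split; last first.
  by move=> s /andP[? ?]; apply/angle_pi/ta; lra.
move=> s; apply: cvgD; last exact: cvg_cst.
apply: (cvg_comp (fun s => 1 - s) t); last exact: tc.
by apply: cvgB; [exact: cvg_cst|exact: cvg_id].
Qed.

Lemma same_rotation_ext g g' h h' :
  (forall s, 0 <= s <= 1 -> g s = g' s) ->
  (forall s, 0 <= s <= 1 -> h s = h' s) ->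
  same_rotation g h -> same_rotation g' h'.
Proof.
move=> gg hh [t [t' [[tc ta] [tc' ta'] t0 t1]]]; exists t, t'; split=> //; split=> // s s01.
  by rewrite -gg//; exact: ta.
by rewrite -hh//; exact: ta'.
Qed.

(** The second coordinate is the deformation parameter. At both ends the acute angle keeps the
    cosine of the difference of the lifts positive, so this difference cannot cross [pi / 2]. *)
Lemma same_rotation_homotopy (V W : R * R -> R * R) :
  (forall p, usquare p -> {for p, continuous V} /\ V p != 0) ->
  (forall p, usquare p -> {for p, continuous W} /\ W p != 0) ->
  (forall r, 0 <= r <= 1 ->
    0 < dot (V (0, r)) (W (0, r)) /\ 0 < dot (V (1, r)) (W (1, r))) ->
  same_rotation (fun s => V (s, 0)) (fun s => W (s, 0)) ->
  same_rotation (fun s => V (s, 1)) (fun s => W (s, 1)).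
Proof.
move=> Vc Wc VW [t [t' [tV tW t0 t1]]].
have I0 : 0 <= (0 : R) <= 1 by rewrite lexx ler01.
have I1 : 0 <= (1 : R) <= 1 by rewrite lexx ler01.
(* A lift over the square, shifted by a multiple of a full turn so as to extend the given lift of
   the bottom side. *)
have aux (X : R * R -> R * R) (q : R -> R) :
    (forall p, usquare p -> {for p, continuous X} /\ X p != 0) ->
    lift q (fun s => X (s, 0)) ->
    exists psi : R * R -> R, [/\ continuous psi,
      forall p, usquare p -> angle (psi p) (X p),
      psi (0, 0) = q 0 & psi (1, 0) = q 1].
  move=> Xc qX.
  have [p /Xc[]//|p /Xc[]//|psi pc pa] := @rect_lift _ X.
  have lp : lift (fun s => psi (s, 0)) (fun s => X (s, 0)).
    split; last by move=> s s01; apply: pa; apply/usquareP.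
    move=> s; apply: (cvg_comp (fun s => (s, 0)) psi); last exact: pc.
    by apply: cvg_pr; [exact: cvg_id|exact: cvg_cst].
  have E := lift_var lp qX; rewrite /= in E.
  have c1 : cos (psi (0, 0) - q 0) = 1 by exact: angle_unique (lp.2 _ I0) (qX.2 _ I0).
  exists (fun p => psi p - (psi (0, 0) - q 0)); split=> [p|p pu||].
  - by apply: cvgB; [exact: pc|exact: cvg_cst].
  - by apply: angle_shift => //; exact: pa.
  - by rewrite subKr.
  - by lra.
have [a [ac aa a0 a1]] := aux V t Vc tV.
have [b [bc ba b0 b1]] := aux W t' Wc tW.
exists (fun s => a (s, 1)), (fun s => b (s, 1)).
have slice (c : R * R -> R) : continuous c -> continuous (fun s => c (s, 1)).
  move=> cc s; apply: (cvg_comp (fun s => (s, 1)) c); last exact: cc.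
  by apply: cvg_pr; [exact: cvg_id|exact: cvg_cst].
have slice' (c : R * R -> R) (i : R) : continuous c -> continuous (fun r => c (i, r)).
  move=> cc r; apply: (cvg_comp (fun r => (i, r)) c); last exact: cc.
  by apply: cvg_pr; [exact: cvg_cst|exact: cvg_id].
split; [split|split| |].
- exact: slice.
- by move=> s s01; apply: aa; apply/usquareP.
- exact: slice.
- by move=> s s01; apply: ba; apply/usquareP.
- apply: (@close_end _ (fun r => a (0, r) - b (0, r))); last by rewrite a0 b0.
    by move=> r; apply: cvgB; exact: slice'.
  move=> r; rewrite in_itv/= => r01.
  rewrite -(@angle_dot_gt0 _ _ _ (V (0, r)) (W (0, r))); first exact: (VW r r01).1.
    by apply: aa; apply/usquareP.
  by apply: ba; apply/usquareP.
- apply: (@close_end _ (fun r => a (1, r) - b (1, r))); last by rewrite a1 b1.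
    by move=> r; apply: cvgB; exact: slice'.
  move=> r; rewrite in_itv/= => r01.
  rewrite -(@angle_dot_gt0 _ _ _ (V (1, r)) (W (1, r))); first exact: (VW r r01).2.
    by apply: aa; apply/usquareP.
  by apply: ba; apply/usquareP.
Qed.

Lemma cos_le0 (x : R) : pi / 2 <= `|x| <= 3 / 2 * pi -> cos x <= 0.
Proof.
move=> /andP[x1 x2]; rewrite -cos_norm -[`|x|](subrK pi) cosDpi oppr_le0.
by apply: cos_ge0_pihalf; lra.
Qed.

Lemma lt_pihalf (x : R) : `|x| < 3 / 2 * pi -> 0 < cos x -> `|x| < pi / 2.
Proof.
move=> x1 x2; rewrite ltNge; apply/negP => x3.
by have := @cos_le0 x; rewrite x3 (ltW x1) => /(_ isT); lra.
Qed.

Lemma cosB2pi (x : R) : cos (x - 2 * pi) = cos x.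
Proof. by rewrite -[RHS](congr1 cos (subrK (2 * pi) x)) mulr_natl cosD2pi. Qed.

Lemma cos1_eq0 (x : R) : cos x = 1 -> `|x| < 2 * pi -> x = 0.
Proof.
move=> x1 x2; apply/eqP; rewrite -normr_eq0; apply/negPn/negP => x0.
have x0' : 0 < `|x| by rewrite lt_def x0 normr_ge0.
have [xpi|xpi] := lerP `|x| pi.
  by have := @cos_lt1 _ x; rewrite x0' xpi => /(_ isT); lra.
have := @cos_lt1 _ (2 * pi - `|x|).
have E : cos (2 * pi - `|x|) = 1.
  by rewrite -cosN opprB cosB2pi cos_norm.
rewrite E ltxx; have -> : 0 < `|2 * pi - `|x| | <= pi :> bool; last by move/(_ isT).
by rewrite gtr0_norm; lra.
Qed.

Lemma angle_mod (x : R) : exists2 z, 0 <= z <= 2 * pi & cos (x - z) = 1.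
Proof.
have cx : -1 <= cos x <= 1 by rewrite cos_geN1 cos_le1.
have [a0 api] := (acos_ge0 cx, acos_lepi cx).
have sx : Num.sqrt (1 - cos x ^+ 2) = `|sin x| by rewrite -sin2cos2 sqrtr_sqr.
have cs := cos2Dsin2 x.
have [s0|s0] := lerP 0 (sin x).
  exists (acos (cos x)); first by have := @pi_ge0 R; lra.
  by rewrite cosB acosK ?in_itv//= sin_acos// sx ger0_norm.
exists (2 * pi - acos (cos x)); first by have := @pi_ge0 R; lra.
have -> : cos (x - (2 * pi - acos (cos x))) = cos (x + acos (cos x)).
  by rewrite -[RHS]cosB2pi; congr cos; ring.
rewrite cosD acosK ?in_itv//= sin_acos// sx ltr0_norm//.
by rewrite -cs; ring.
Qed.

(** The path avoids the cone of half angle [pi / 4] about [n], so its argument is trapped in the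
    window of half width [3 / 4 * pi] about the opposite direction. *)
Lemma cone_lift (n : R * R) (al : R) g : angle al n -> nonvanishing g ->
  (forall s, 0 <= s <= 1 -> dot n (g s) < cos (pi / 4) * (len n * len (g s))) ->
  exists2 t, lift t g &
    `|t 0 - al - pi| < 3 / 4 * pi /\ `|t 1 - al - pi| < 3 / 4 * pi.
Proof.
move=> na gn gcone; have [t tg] := path_lift gn.
have pi0 := @pi_gt0 R.
(* This representative puts [h 0] between [- pi] and [pi], where the cosine determines the absolute
   value. *)
have [z z2 zc] := angle_mod (t 0 - al).
have [uc ua] := lift_shift zc tg.
set u := (fun s => t s - _) in uc ua *.
pose h s := u s - al - pi.
have hc : continuous h.
  by move=> s; apply: cvgB; [apply: cvgB; [exact: uc|exact: cvg_cst]|exact: cvg_cst].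
have hcos s : 0 <= s <= 1 -> cos (3 / 4 * pi) < cos (h s).
  move=> s01; have := gcone s s01; rewrite (angle_dot na (ua s s01)).
  have n0 : 0 < len n by case: na.
  have g0 : 0 < len (g s) by case: (ua s s01).
  rewrite mulrC ltr_pM2r ?mulr_gt0// => H.
  have -> : 3 / 4 * pi = - (pi / 4) + pi :> R by lra.
  have -> : cos (h s) = - cos (u s - al).
    by rewrite -[in RHS](subrK pi (u s - al)) cosDpi opprK.
  by rewrite cosDpi cosN ltrN2 -cosN opprB.
have I0 : 0 <= (0 : R) <= 1 by rewrite lexx ler01.
have h0 : `|h 0| < 3 / 4 * pi.
  rewrite ltNge; apply/negP => H; have := hcos 0 I0.
  have hpi : `|h 0| <= pi.
    rewrite ler_norml /h /u; apply/andP; split; lra.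
  have A1 : (3 / 4 * pi : R) \in `[0, (pi : R)]%R by rewrite in_itv/=; lra.
  have A2 : `|h 0| \in `[0, (pi : R)]%R by apply/andP; split; [exact: normr_ge0|exact: hpi].
  by rewrite -(cos_norm (h 0)) ltr_cos// ltNge H.
exists u; first by split.
split; first exact: h0.
rewrite ltNge; apply/negP => h1.
have [s s01 hs] := ivt_norm hc h0 h1.
by rewrite in_itv/= in s01; have := hcos s s01; rewrite -(cos_norm (h s)) hs ltxx.
Qed.

(** Both arguments lie in one window of width [3 / 2 * pi], and a difference below that bound with
    positive cosine is below [pi / 2]. The half angle [pi / 4] is the smallest for which this
    works. *)
Lemma cone_same_rotation (n : R * R) g h : n != 0 ->
  nonvanishing g -> nonvanishing h ->
  (forall s, 0 <= s <= 1 -> dot n (g s) < cos (pi / 4) * (len n * len (g s))) ->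
  (forall s, 0 <= s <= 1 -> dot n (h s) < cos (pi / 4) * (len n * len (h s))) ->
  0 < dot (g 0) (h 0) -> 0 < dot (g 1) (h 1) -> same_rotation g h.
Proof.
move=> /angle_exists[al na] gn hn gc hc gh0 gh1.
have I0 : 0 <= (0 : R) <= 1 by rewrite lexx ler01.
have I1 : 0 <= (1 : R) <= 1 by rewrite lexx ler01.
have [t tg [t0 t1]] := cone_lift na gn gc.
have [q qh [q0 q1]] := cone_lift na hn hc.
exists t, q; split=> //.
  apply: lt_pihalf; last by rewrite -(angle_dot_gt0 (tg.2 _ I0) (qh.2 _ I0)).
  by move: t0 q0; rewrite !ltr_norml => /andP[? ?] /andP[? ?]; apply/andP; split; lra.
apply: lt_pihalf; last by rewrite -(angle_dot_gt0 (tg.2 _ I1) (qh.2 _ I1)).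
by move: t1 q1; rewrite !ltr_norml => /andP[? ?] /andP[? ?]; apply/andP; split; lra.
Qed.

Definition rev_path u : R -> R * R := fun s => - u (1 - s).

(* The total rotation of the path from one arc to a parallel one is an odd
   multiple of pi, up to the directions of the endpoints, and is negated when
   the arcs are swapped. *)
Lemma no_three_same_rotations (u01 u02 u12 : R -> R * R) :
  let dots u := [/\ 0 < dot (u01 0) (u 0) , 0 < dot (rev_path u01 0) (u 0),
    0 < dot (u02 0) (u 0), 0 < dot (rev_path u02 0) (u 0) &
    0 < dot (u12 0) (u 0) /\ 0 < dot (rev_path u12 0) (u 0)] in
  [/\ dots (rev_path u01), dots u02, dots (rev_path u02), dots u12 & dots (rev_path u12)] ->
  same_rotation u01 u02 -> same_rotation (rev_path u01) u12 ->
  same_rotation (rev_path u02) (rev_path u12) -> False.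
Proof.
move=> dots [d10 d02 d20 d12 d21].
move=> [a [b [la lb ab0 ab1]]] [a' [c [la' lc ac0 ac1]]] [b' [c' [lb' lc' bc0 bc1]]].
have I0 : 0 <= (0 : R) <= 1 by rewrite lexx ler01.
have I1 : 0 <= (1 : R) <= 1 by rewrite lexx ler01.
have pi0 := @pi_gt0 R.
have ra := lift_var (lift_rev la) la'.
have rb := lift_var (lift_rev lb) lb'.
have rc := lift_var (lift_rev lc) lc'.
rewrite /= subrr subr0 in ra rb rc.
(* All starting vectors make acute angles with [u01 0], so they receive arguments on one branch near
   [a 0]. *)
have wex (v : R * R) : 0 < dot (u01 0) v -> exists2 w, angle w v & `|a 0 - w| < pi / 2.
  move=> v0; exists (a 0 + atan (crs (u01 0) v / dot (u01 0) v)).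
    by apply: angle_step => //; exact: la.2 _ I0.
  rewrite opprD addrA subrr sub0r normrN.
  by rewrite ltr_norml atan_gtNpi2 atan_ltpi2.
have [w10 A10 w10a] : exists2 w, angle w (rev_path u01 0) & `|a 0 - w| < pi / 2.
  by apply: wex; case: d10.
have [w02 A02 w02a] : exists2 w, angle w (u02 0) & `|a 0 - w| < pi / 2.
  by apply: wex; case: d02.
have [w20 A20 w20a] : exists2 w, angle w (rev_path u02 0) & `|a 0 - w| < pi / 2.
  by apply: wex; case: d20.
have [w12 A12 w12a] : exists2 w, angle w (u12 0) & `|a 0 - w| < pi / 2.
  by apply: wex; case: d12.
have [w21 A21 w21a] : exists2 w, angle w (rev_path u12 0) & `|a 0 - w| < pi / 2.
  by apply: wex; case: d21.
have A01 : angle (a 0) (u01 0) by exact: la.2.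
have close (w w' : R) (v v' : R * R) : angle w v -> angle w' v' -> 0 < dot v v' ->
    `|a 0 - w| < pi / 2 -> `|a 0 - w'| < pi / 2 -> `|w - w'| < pi / 2.
  move=> wv wv' vv; rewrite !ltr_norml => /andP[? ?] /andP[? ?].
  rewrite -ltr_norml; apply: lt_pihalf; last by rewrite -(angle_dot_gt0 wv wv').
  by rewrite ltr_norml; apply/andP; split; lra.
(* As [rev_path u 0] is [- u 1], the rotation of [u] corrected by the angle from [u 0] to
   [rev_path u 0] is an odd multiple of [pi]. *)
have x_cos t u w w' : lift t u -> angle w (u 0) -> angle w' (rev_path u 0) ->
    cos (t 1 - t 0 - (w' - w)) = -1.
  move=> lt w0 w1.
  have := angle_pi w1; rewrite /rev_path subr0 opprK => w1'.
  have c1 := angle_unique (lt.2 _ I1) w1'.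
  have c0 := angle_unique (lt.2 _ I0) w0.
  have s1 : sin (t 1 - (w' + pi)) = 0 by apply: cos1sin0; rewrite c1 normr1.
  have s0 : sin (t 0 - w) = 0 by apply: cos1sin0; rewrite c0 normr1.
  have -> : t 1 - t 0 - (w' - w) = (t 1 - (w' + pi)) - (t 0 - w) + pi by ring.
  by rewrite cosDpi cosB c1 c0 s1 s0; ring.
have X01 := x_cos _ _ _ _ la A01 A10.
have X02 := x_cos _ _ _ _ lb A02 A20.
have X12 := x_cos _ _ _ _ lc A12 A21.
set x01 := a 1 - a 0 - _ in X01.
set x02 := b 1 - b 0 - _ in X02.
set x12 := c 1 - c 0 - _ in X12.
(* Each of the three comparisons below adds four differences under a quarter turn, hence stays under
   [2 * pi], the gap between odd multiples of [pi]. *)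
have eqx (x y : R) : cos x = -1 -> cos y = -1 -> `|x - y| < 2 * pi -> x = y.
  move=> cx cy xy; apply/eqP; rewrite -subr_eq0; apply/eqP; apply: cos1_eq0 => //.
  have sx : sin x = 0 by apply: cos1sin0; rewrite cx normrN normr1.
  by rewrite cosB cx cy sx; ring.
have K01 : `|a 0 - a 0| < pi / 2 by rewrite subrr normr0; lra.
have E1 : x01 = x02.
  apply: eqx => //.
  have H1 := close _ _ _ _ A10 A20 (let: And5 _ H _ _ _ := d20 in H) w10a w20a.
  move: ab0 ab1 w02a H1; rewrite !ltr_norml /x01 /x02.
  by move=> /andP[? ?] /andP[? ?] /andP[? ?] /andP[? ?]; apply/andP; split; lra.
have E2 : - x01 = x12.
  apply: eqx => //; first by rewrite cosN.
  have H1 := close _ _ _ _ A10 A12 (let: And5 _ H _ _ _ := d12 in H) w10a w12a.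
  move: ac0 ac1 w21a H1; rewrite !ltr_norml /x01 /x12.
  by move=> /andP[? ?] /andP[? ?] /andP[? ?] /andP[? ?]; apply/andP; split; lra.
have E3 : - x02 = - x12.
  apply: eqx => //; rewrite ?cosN//.
  have H1 := close _ _ _ _ A20 A21 (let: And5 _ _ _ H _ := d21 in H) w20a w21a.
  have H2 := close _ _ _ _ A02 A12 (let: And5 _ _ H _ _ := d12 in H) w02a w12a.
  move: bc0 bc1 H1 H2; rewrite !ltr_norml /x02 /x12.
  by move=> /andP[? ?] /andP[? ?] /andP[? ?] /andP[? ?]; apply/andP; split; lra.
have x0 : x01 = 0 by lra.
by move: X01; rewrite x0 cos0; lra.
Qed.

End Rotation.

(** * Polar interpolation between plane vectors *)

Section PolarInterpolation.
Variable R : realType.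

Lemma cvg_len (T : Type) (F : set_system T) (FF : Filter F)
    (f : T -> R * R) (u : R * R) :
  f x @[x --> F] --> u -> len (f x) @[x --> F] --> len u.
Proof.
move=> fu; apply: (cvg_comp (fun x => dot (f x) (f x)) Num.sqrt).
  exact: (@cvg_dot _ _ _ _ f f u u fu fu).
exact: sqrt_continuous.
Qed.

Lemma cos_lipschitz (x y : R) : `|cos y - cos x| <= `|y - x|.
Proof.
wlog xy : x y / x <= y => [H|].
  have /orP[/H//|/H h] := le_total x y.
  by rewrite (distrC (cos y)) (distrC y).
have [|z _ ->] := @MVT_segment R cos (fun x => - sin x) x y xy _.
  exact: continuous_subspaceT (@continuous_cos R).
by rewrite normrM normrN ler_piMl// sin_max.
Qed.

Lemma sin_lipschitz (x y : R) : `|sin y - sin x| <= `|y - x|.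
Proof. by rewrite -!cosBpihalf (le_trans (cos_lipschitz _ _))// opprB addrA subrK. Qed.

Lemma norm_le_len (v : R * R) : `|v| <= len v.
Proof.
rewrite prod_normE /= ge_max -!sqrtr_sqr.
by apply/andP; split; rewrite ler_wsqrtr// /dot -!expr2; rewrite ?lerDl ?lerDr sqr_ge0.
Qed.

Lemma len_le_norm (v : R * R) : len v <= 2 * `|v|.
Proof.
have n0 : 0 <= 2 * `|v| by rewrite mulr_ge0.
rewrite -(ger0_norm n0) -sqrtr_sqr ler_wsqrtr//.
have h1 : v.1 ^+ 2 <= `|v| ^+ 2.
  by rewrite -[v.1 ^+ 2]real_normK ?num_real// lerXn2r ?nnegrE// prod_normE/= le_max lexx.
have h2 : v.2 ^+ 2 <= `|v| ^+ 2.
  by rewrite -[v.2 ^+ 2]real_normK ?num_real// lerXn2r ?nnegrE// prod_normE/= le_max lexx orbT.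
have := sqr_ge0 `|v|; rewrite /dot -!expr2 exprMn; lra.
Qed.

(** Radius and argument move separately, so the path avoids 0 even between opposite vectors, where a
    segment would not. The arguments [t] and [t'] come from lifts and may differ by any number of
    turns from the principal ones. *)
Definition interp (u w : R * R) (t t' a : R) : R * R :=
  polar ((1 - a) * len u + a * len w) ((1 - a) * t + a * t').

Lemma interp_norm (u w : R * R) t t' a c : 0 <= a <= 1 ->
  len u < c -> len w < c -> `|interp u w t t' a| < c.
Proof.
move=> /andP[a0 a1] uc wc; apply: le_lt_trans (norm_le_len _) _.
have [u0 w0] := (len_ge0 u, len_ge0 w).
rewrite len_polar; last by rewrite addr_ge0// mulr_ge0// subr_ge0.
pose m := Num.max (len u) (len w).
have mc : m < c by rewrite gt_max uc.
have um : len u <= m by rewrite le_max lexx.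
have wm : len w <= m by rewrite le_max lexx orbT.
by apply: le_lt_trans mc; nra.
Qed.

Lemma cvg_interp (T : Type) (E : set_system T) (FE : Filter E)
    (u_ w_ : T -> R * R) (t_ t'_ a_ : T -> R) (u w : R * R) (t t' a : R) :
  u_ z @[z --> E] --> u -> w_ z @[z --> E] --> w ->
  t_ z @[z --> E] --> t -> t'_ z @[z --> E] --> t' -> a_ z @[z --> E] --> a ->
  interp (u_ z) (w_ z) (t_ z) (t'_ z) (a_ z) @[z --> E] --> interp u w t t' a.
Proof.
move=> uu ww tt tt' aa.
have bb : 1 - a_ z @[z --> E] --> 1 - a by apply: cvgB => //; exact: cvg_cst.
have cr : (1 - a_ z) * len (u_ z) + a_ z * len (w_ z) @[z --> E] -->
    (1 - a) * len u + a * len w.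
  by apply: cvgD; apply: cvgM => //; exact: cvg_len.
have ct : (1 - a_ z) * t_ z + a_ z * t'_ z @[z --> E] --> (1 - a) * t + a * t'.
  by apply: cvgD; apply: cvgM.
rewrite /interp /polar; apply: cvg_pr; apply: cvgM => //.
  exact: (cvg_comp _ cos ct (@continuous_cos _ _)).
exact: (cvg_comp _ sin ct (@continuous_sin _ _)).
Qed.

Lemma interp0 (u w : R * R) t t' : angle t u -> interp u w t t' 0 = u.
Proof. by move=> [_ {2}->]; rewrite /interp subr0 !mul1r !mul0r !addr0. Qed.

Lemma interp1 (u w : R * R) t t' : angle t' w -> interp u w t t' 1 = w.
Proof. by move=> [_ {2}->]; rewrite /interp subrr !mul1r !mul0r !add0r. Qed.

Lemma interp_neq0 (u w : R * R) t t' a : 0 <= a <= 1 -> u != 0 -> w != 0 ->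
  interp u w t t' a != 0.
Proof.
rewrite -!len_gt0 => /andP[a0 a1] u0 w0.
have r0 : 0 < (1 - a) * len u + a * len w.
  have [a2|a2] := ltP a 1.
    apply: ltr_pwDl; first by rewrite mulr_gt0// subr_gt0.
    by rewrite mulr_ge0// ltW.
  have -> : a = 1 by lra.
  by rewrite subrr mul0r add0r mul1r.
by rewrite /interp len_polar// ltW.
Qed.

(** Arguments less than a quarter turn apart make the interpolation take the short way round, hence
    stay near [v]. *)
Lemma interp_near (v : R * R) (O : set (R * R)) : v != 0 -> nbhs v O ->
  \forall u \near v & w \near v, forall t t', angle t u -> angle t' w ->
    `|t - t'| < pi / 2 -> forall a, 0 <= a <= 1 -> O (interp u w t t' a).
Proof.
move=> v0 /nbhs_ballP[e /= e0 be].
have e3 : 0 < e / 3 by rewrite divr_gt0.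
have fstv : (p : (R * R) * (R * R)).1 @[p --> (v, v)] --> v by exact: cvg_fst.
have sndv : (p : (R * R) * (R * R)).2 @[p --> (v, v)] --> v by exact: cvg_snd.
have C1 : len p.2 - len p.1 @[p --> (v, v)] --> (0 : R).
  by rewrite -(subrr (len v)); apply: cvgB; exact: cvg_len.
have C2 : len p.1 * atan (crs p.1 p.2 / dot p.1 p.2) @[p --> (v, v)] --> (0 : R).
  have -> : 0 = len v * atan (crs v v / dot v v).
    by have -> : crs v v = 0 by [rewrite /crs; ring]; rewrite mul0r atan0 mulr0.
  apply: cvgM; first exact: cvg_len.
  apply: (cvg_comp (fun p => crs p.1 p.2 / dot p.1 p.2) atan); last exact: continuous_atan.
  apply: cvgM; first exact: cvg_crs.
  apply: cvgV; last exact: cvg_dot.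
  by rewrite -len2 expf_neq0// gt_eqF// len_gt0.
have N1 := cvgr_dist_lt _ _ C1 _ e3.
have N2 := cvgr_dist_lt _ _ C2 _ e3.
have N3 := cvgr_dist_lt _ _ fstv _ e3.
have N4 := dot_gt0_near v0.
suff : nbhs (v, v) [set p : (R * R) * (R * R) | forall t t',
    angle t p.1 -> angle t' p.2 -> `|t - t'| < pi / 2 ->
    forall a, 0 <= a <= 1 -> O (interp p.1 p.2 t t' a)] by [].
near=> p.
have n1 : `|0 - (len p.2 - len p.1)| < e / 3 by near: p; exact: N1.
have n2 : `|0 - len p.1 * atan (crs p.1 p.2 / dot p.1 p.2)| < e / 3.
  by near: p; exact: N2.
have n3 : `|v - p.1| < e / 3 by near: p; exact: N3.
have n4' : 0 < dot p.1 p.2 by near: p; exact: N4.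
rewrite /mkset; move: (p.1) (p.2) n1 n2 n3 n4' => u w n1 n2 n3 n4' /=.
move=> t t' tu tw tt a /andP[a0 a1].
apply: be; rewrite -ball_normE /=.
(* Both sides are angles from [u] to [w] of absolute value below [pi / 2], so they agree exactly and
   not only modulo a full turn. *)
have bE : t' - t = atan (crs u w / dot u w).
  have H := angle_step tu n4'; set q := atan _ in H *.
  have c1 := angle_unique tw H.
  suff : t' - (t + q) = 0 by lra.
  apply: cos1_eq0 => //.
  have := atan_gtNpi2 (crs u w / dot u w); have := atan_ltpi2 (crs u w / dot u w).
  rewrite -/q; move: tt; have := @pi_gt0 R; rewrite !ltr_norml => ? /andP[? ?] ? ?.
  by apply/andP; split; lra.
rewrite sub0r normrN in n1; rewrite sub0r normrN in n2.
rewrite -bE normrM (gtr0_norm tu.1) in n2.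
(* The error splits into a radial part, bounded by the change of length, and an angular part,
   bounded by the arc of radius [len u]. *)
have comp (f : R -> R) : (forall x, `|f x| <= 1) ->
    (forall x y, `|f y - f x| <= `|y - x|) ->
    `|((1 - a) * len u + a * len w) * f ((1 - a) * t + a * t') - len u * f t| < e / 3 + e / 3.
  move=> f1 fL.
  have -> : ((1 - a) * len u + a * len w) * f ((1 - a) * t + a * t') - len u * f t =
    a * (len w - len u) * f ((1 - a) * t + a * t') +
    len u * (f ((1 - a) * t + a * t') - f t) by ring.
  apply: le_lt_trans (ler_normD _ _) _; apply: ltrD.
    rewrite !normrM; apply: le_lt_trans n1.
    rewrite -[leRHS]mulr1 ler_pM// ger0_norm//.
    by rewrite ler_piMl.
  rewrite normrM (gtr0_norm tu.1); apply: le_lt_trans n2.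
  rewrite ler_pM2l; last by case: tu.
  apply: le_trans (fL _ _) _.
  have -> : (1 - a) * t + a * t' - t = a * (t' - t) by ring.
  by rewrite normrM ger0_norm// ler_piMl.
have K1 := comp cos (@cos_max R) cos_lipschitz.
have K2 := comp sin (@sin_max R) sin_lipschitz.
have uE1 : u.1 = len u * cos t by case: tu => _ {1}->.
have uE2 : u.2 = len u * sin t by case: tu => _ {1}->.
rewrite -uE1 in K1; rewrite -uE2 in K2.
move: n3; rewrite !prod_normE /= !gt_max => /andP[m1 m2].
have -> : e = e / 3 + (e / 3 + e / 3) by lra.
apply/andP; split.
  apply: le_lt_trans (ler_distD u.1 _ _) _; apply: ltrD => //.
  by rewrite distrC.
apply: le_lt_trans (ler_distD u.2 _ _) _; apply: ltrD => //.
by rewrite distrC.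
Unshelve. all: by end_near. Qed.

End PolarInterpolation.

(** * Sides of a flow arc in a surface *)

Section Charts.
Variables (R : realType) (F : topologicalType).

(** Total functions avoid subset types. The last clause says that the image of [U] is open and that
    [k] is a continuous inverse there, without naming that image. *)
Definition chart (U : set F) (g : F -> R * R) (k : R * R -> F) :=
  [/\ open U, forall q, U q -> {for q, continuous g},
      forall q, U q -> k (g q) = q &
      forall q, U q -> \forall v \near g q,
        [/\ U (k v), g (k v) = v & {for v, continuous k}]].

Lemma chart_sub U g k W : chart U g k -> open W -> W `<=` U -> chart W g k.
Proof.
move=> [oU gc kg gk] oW WU; split=> // [q /WU/gc//|q /WU/kg//|q Wq].
have Uq := WU _ Wq; have gkq := gk q Uq.
have kc : {for g q, continuous k} by have [] := nbhs_singleton gkq.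
have : \forall v \near g q, W (k v).
  by apply: kc; rewrite kg//; exact: open_nbhs_nbhs.
move=> H; near=> v.
have [U1 U2 U3] : [/\ U (k v), g (k v) = v & {for v, continuous k}].
  by near: v; exact: gkq.
split=> //; near: v; exact: H.
Unshelve. all: by end_near. Qed.

Lemma chart_inj U g k p q : chart U g k -> U p -> U q -> g p = g q -> p = q.
Proof. by move=> [_ _ kg _] /kg {2}<- /kg {2}<- ->. Qed.

Variables (Th : topologicalType) (phi : R -> Th -> Th) (f : Th -> F).
Hypothesis phi_continuous : continuous (fun p : R * Th => phi p.1 p.2).
Hypothesis phi_aperiodic : forall s t x, phi s x = phi t x -> s = t.
Hypothesis f_continuous : continuous f.
Hypothesis f_inj : injective f.

Definition read (g : F -> R * R) (x : Th) (s : R) : R * R := g (f (phi s x)).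

Definition cross (g : F -> R * R) (a b : R) (x x' : Th) (s : R) : R * R :=
  read g x' (b - s * (b - a)) - read g x (a + s * (b - a)).

(* The flow arcs of x' and x'' over [a, b] lie on the same side of that of x:
   reading the arcs in opposite directions turns the chords by the same angle. *)
Definition same_side g a b x x' x'' :=
  same_rotation (cross g a b x x') (cross g a b x x'').

Definition stays (U : set F) a b x := forall s, a <= s <= b -> U (f (phi s x)).

(** The two times are independent because the homotopies pass through chords between unrelated
    times. *)
Definition apart a b x x' :=
  forall s t, a <= s <= b -> a <= t <= b -> phi t x' <> phi s x.

Lemma cvg_phi (T : Type) (E : set_system T) (FE : Filter E) (s_ : T -> R)
    (x_ : T -> Th) s x : s_ z @[z --> E] --> s -> x_ z @[z --> E] --> x ->
  f (phi (s_ z) (x_ z)) @[z --> E] --> f (phi s x).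
Proof.
move=> ss xx; apply: (cvg_comp (fun z => phi (s_ z) (x_ z)) f).
  have c : (s_ z, x_ z) @[z --> E] --> ((s, x) : R * Th) by exact: cvg_pr.
  exact: (cvg_comp _ (fun p : R * Th => phi p.1 p.2) c (@phi_continuous (s, x))).
exact: f_continuous.
Qed.

Lemma cvg_read U g k (T : Type) (E : set_system T) (FE : Filter E) (s_ : T -> R)
    (x_ : T -> Th) s x : chart U g k -> U (f (phi s x)) ->
  s_ z @[z --> E] --> s -> x_ z @[z --> E] --> x ->
  read g (x_ z) (s_ z) @[z --> E] --> read g x s.
Proof.
move=> [_ gc _ _] Us ss xx.
apply: (cvg_comp (fun z => f (phi (s_ z) (x_ z))) g); last exact: gc.
exact: cvg_phi.
Qed.

Lemma read_continuous U g k x s : chart U g k -> U (f (phi s x)) ->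
  {for s, continuous (read g x)}.
Proof.
move=> ch Us; have cx : x @[_ --> s] --> x by exact: cvg_cst.
have cs : r @[r --> s] --> s by exact: cvg_id.
exact: (cvg_read (nbhs_filter s) ch Us cs cx).
Qed.

Lemma cvg_dot_read U g k (T : Type) (E : set_system T) (FE : Filter E)
    (s_ t_ : T -> R) (x1 x2 x3 x4 : T -> Th) s t y : chart U g k ->
  U (f (phi s y)) -> U (f (phi t y)) ->
  s_ z @[z --> E] --> s -> t_ z @[z --> E] --> t ->
  x1 z @[z --> E] --> y -> x2 z @[z --> E] --> y ->
  x3 z @[z --> E] --> y -> x4 z @[z --> E] --> y ->
  dot (read g (x2 z) (t_ z) - read g (x1 z) (s_ z))
      (read g (x4 z) (t_ z) - read g (x3 z) (s_ z)) @[z --> E] -->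
  dot (read g y t - read g y s) (read g y t - read g y s).
Proof.
move=> ch Us Ut ss tt c1 c2 c3 c4.
by apply: cvg_dot; apply: cvgB; apply: (cvg_read _ ch).
Qed.

Lemma near_stays U a b y : open U -> stays U a b y ->
  \forall x \near y, stays U a b x.
Proof.
move=> oU Uy.
have /compact_near_coveringP cK := @segment_compact R a b.
have := @cK Th (nbhs y) (fun x s => U (f (phi s x))) (nbhs_filter y).
move=> H; have {H} : \forall x \near y, `[a, b]%classic `<=` (fun s => U (f (phi s x))).
  apply: H => s; rewrite /= in_itv/= => sab.
  have : f (phi p.1 p.2) @[p --> (s, y)] --> f (phi s y).
    by apply: cvg_phi; [exact: cvg_fst|exact: cvg_snd].
  apply; apply: open_nbhs_nbhs; split=> //; exact: Uy.
by apply: filterS => x Hx s sab; apply: Hx; rewrite /= in_itv.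
Qed.

Lemma read_neq U g k a b y s t : chart U g k -> stays U a b y ->
  a <= s <= b -> a <= t <= b -> s != t -> read g y t - read g y s != 0.
Proof.
move=> ch Uy sab tab; apply: contra; rewrite subr_eq0 => /eqP E.
by apply/eqP/esym/(phi_aperiodic (x := y))/f_inj/(chart_inj ch) => //; exact: Uy.
Qed.

(** Near [y] all these chords resemble the chord of the arc of [y] between the same times, which is
    nonzero by aperiodicity. The gap [e] makes the set of pairs of times compact; four separate
    points allow chords that join different arcs. *)
Lemma near_dots U g k a b y e : chart U g k -> stays U a b y -> 0 < e ->
  exists2 O : set Th, nbhs y O &
    forall x1 x2 x3 x4, O x1 -> O x2 -> O x3 -> O x4 ->
    forall s t, a <= s <= b -> a <= t <= b -> e <= `|t - s| ->
    0 < dot (read g x2 t - read g x1 s) (read g x4 t - read g x3 s).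
Proof.
move=> ch Uy e0.
pose K : set (R * R) := (`[a, b] `*` `[a, b]) `&` [set p | e <= `|p.2 - p.1|].
have cK : compact K.
  apply: compact_closedI; first by apply: compact_setX; exact: segment_compact.
  apply: (@closed_comp _ _ (fun p : R * R => `|p.2 - p.1|) [set r | e <= r]).
    move=> p _; apply: cvg_norm; apply: cvgB; [exact: cvg_snd|exact: cvg_fst].
  exact: closed_ge.
move/compact_near_coveringP in cK.
pose P (X : (Th * Th) * (Th * Th)) (p : R * R) :=
  0 < dot (read g X.1.2 p.2 - read g X.1.1 p.1) (read g X.2.2 p.2 - read g X.2.1 p.1).
have H := @cK _ (nbhs (((y, y), (y, y)) : (Th * Th) * (Th * Th))) P (nbhs_filter _).
have : \forall X \near (((y, y), (y, y)) : (Th * Th) * (Th * Th)), K `<=` P X.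
  apply: H => -[s t] [[/=]]; rewrite !in_itv/= => sab tab est.
  have st : s != t by apply: contraTneq est => ->; rewrite subrr normr0 -ltNge.
  have v0 := read_neq ch Uy sab tab st.
  have : dot (read g z.2.1.2 z.1.2 - read g z.2.1.1 z.1.1)
             (read g z.2.2.2 z.1.2 - read g z.2.2.1 z.1.1)
        @[z --> ((s, t), ((y, y), (y, y)))] -->
      dot (read g y t - read g y s) (read g y t - read g y s).
    have c1 : z.1 @[z --> ((s, t), ((y, y), (y, y)))] --> (s, t) by exact: cvg_fst.
    have c2 : z.2 @[z --> ((s, t), ((y, y), (y, y)))] --> ((y, y), (y, y)) by exact: cvg_snd.
    have c11 : z.1.1 @[z --> ((s, t), ((y, y), (y, y)))] --> s.
      by apply: (cvg_comp fst fst); [exact: c1|exact: cvg_fst].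
    have c12 : z.1.2 @[z --> ((s, t), ((y, y), (y, y)))] --> t.
      by apply: (cvg_comp fst snd); [exact: c1|exact: cvg_snd].
    have c21 : z.2.1 @[z --> ((s, t), ((y, y), (y, y)))] --> (y, y).
      by apply: (cvg_comp snd fst); [exact: c2|exact: cvg_fst].
    have c22 : z.2.2 @[z --> ((s, t), ((y, y), (y, y)))] --> (y, y).
      by apply: (cvg_comp snd snd); [exact: c2|exact: cvg_snd].
    have Us := Uy _ sab; have Ut := Uy _ tab.
    apply: (cvg_dot_read _ ch Us Ut c11 c12).
    - by apply: (cvg_comp (fun z => z.2.1) fst); [exact: c21|exact: cvg_fst].
    - by apply: (cvg_comp (fun z => z.2.1) snd); [exact: c21|exact: cvg_snd].
    - by apply: (cvg_comp (fun z => z.2.2) fst); [exact: c22|exact: cvg_fst].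
    - by apply: (cvg_comp (fun z => z.2.2) snd); [exact: c22|exact: cvg_snd].
  by move/cvgr_gt; apply; rewrite -len2 exprn_gt0// len_gt0.
case=> -[A B] /= [nA nB] sAB.
case: nA => -[A1 A2] /= [yA1 yA2] sA; case: nB => -[B1 B2] /= [yB1 yB2] sB.
exists (A1 `&` A2 `&` (B1 `&` B2)); first by do ![apply: filterI].
move=> x1 x2 x3 x4 [[X1 _] _] [[_ X2] _] [_ [X3 _]] [_ [_ X4]] s t sab tab est.
apply: (sAB ((x1, x2), (x3, x4)) _ (s, t)); last first.
  by split=> //; split; rewrite /= in_itv.
by split; [apply: (sA (x1, x2)) | apply: (sB (x3, x4))].
Qed.

Lemma cross_nonvanishing U g k a b x x' : chart U g k -> a <= b ->
  stays U a b x -> stays U a b x' -> apart a b x x' -> nonvanishing (cross g a b x x').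
Proof.
move=> ch ab Ux Ux' xx' s /andP[s0 s1].
have h1 : a <= a + s * (b - a) <= b by apply/andP; split; nra.
have h2 : a <= b - s * (b - a) <= b by apply/andP; split; nra.
split.
  apply: cvgB.
    apply: (cvg_comp (fun s => b - s * (b - a)) (read g x')); last first.
      exact: read_continuous ch (Ux' _ h2).
    by apply: cvgB; [exact: cvg_cst|apply: cvgMl; exact: cvg_id].
  apply: (cvg_comp (fun s => a + s * (b - a)) (read g x)); last first.
    exact: read_continuous ch (Ux _ h1).
  by apply: cvgD; [exact: cvg_cst|apply: cvgMl; exact: cvg_id].
apply/negP; rewrite subr_eq0 => /eqP E.
apply: (xx' _ _ h1 h2); apply/f_inj/(chart_inj ch) => //; [exact: Ux'|exact: Ux].
Qed.

(** The end points of the interval are moved affinely. All intermediate intervals have length at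
    least [e], so [near_dots] controls the end chords throughout. *)
Lemma same_side_interval U g k a b y e : chart U g k -> stays U a b y -> 0 < e ->
  exists2 O : set Th, nbhs y O & forall x x' x'', O x -> O x' -> O x'' ->
    apart a b x x' -> apart a b x x'' ->
    forall a1 b1 a2 b2, a <= a1 -> a1 + e <= b1 -> b1 <= b ->
      a <= a2 -> a2 + e <= b2 -> b2 <= b ->
    same_side g a1 b1 x x' x'' -> same_side g a2 b2 x x' x''.
Proof.
move=> ch Uy e0; have [N yN Nd] := near_dots ch Uy e0.
have oU : open U by case: ch.
exists (N `&` [set x | stays U a b x]); first by apply: filterI => //; exact: near_stays.
move=> x x' x'' [ox sx] [ox' sx'] [ox'' sx''] ax' ax'' a1 b1 a2 b2 h1 h2 h3 h4 h5 h6.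
pose al r := a1 + r * (a2 - a1); pose be r := b1 + r * (b2 - b1).
have alb r : 0 <= r <= 1 -> [/\ a <= al r, al r + e <= be r & be r <= b].
  by move=> /andP[r0 r1]; rewrite /al /be; split; nra.
pose V z (p : R * R) := read g z (be p.2 - p.1 * (be p.2 - al p.2)) -
  read g x (al p.2 + p.1 * (be p.2 - al p.2)).
have aff (c d : R) : continuous (fun r : R => c + r * d).
  by move=> r; apply: cvgD; [exact: cvg_cst|apply: cvgMl; exact: cvg_id].
have cal (p : R * R) : al q.2 @[q --> p] --> al p.2.
  by apply: (cvg_comp snd al); [exact: cvg_snd|exact: aff].
have cbe (p : R * R) : be q.2 @[q --> p] --> be p.2.
  by apply: (cvg_comp snd be); [exact: cvg_snd|exact: aff].
have V_ok z : stays U a b z -> apart a b x z ->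
    forall p, usquare p -> {for p, continuous (V z)} /\ V z p != 0.
  move=> sz az [s r] /usquareP /= [/andP[s0 s1] r01].
  have [k1 k2 k3] := alb r r01.
  have m1 : a <= be r - s * (be r - al r) <= b by apply/andP; split; nra.
  have m2 : a <= al r + s * (be r - al r) <= b by apply/andP; split; nra.
  split.
    have c1 : p.1 @[p --> (s, r)] --> s by exact: cvg_fst.
    have c2 := cbe (s, r); have c3 := cal (s, r).
    apply: cvgB.
      apply: (cvg_comp (fun p : R * R => be p.2 - p.1 * (be p.2 - al p.2)) (read g z)).
        by apply: cvgB; [exact: c2|apply: cvgM; [exact: c1|exact: cvgB c2 c3]].
      exact: read_continuous ch (sz _ m1).
    apply: (cvg_comp (fun p : R * R => al p.2 + p.1 * (be p.2 - al p.2)) (read g x)).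
      by apply: cvgD; [exact: c3|apply: cvgM; [exact: c1|exact: cvgB c2 c3]].
    exact: read_continuous ch (sx _ m2).
  apply/negP; rewrite subr_eq0 => /eqP E.
  apply: (az _ _ m2 m1); apply/f_inj/(chart_inj ch) => //; [exact: sz|exact: sx].
move=> H.
have := @same_rotation_homotopy R (V x') (V x'') (V_ok _ sx' ax') (V_ok _ sx'' ax'').
move=> H'; apply: same_rotation_ext (H' _ _) => [s _|s _|r r01|].
- by rewrite /V /cross /al /be /=; congr (read _ _ _ - read _ _ _); ring.
- by rewrite /V /cross /al /be /=; congr (read _ _ _ - read _ _ _); ring.
- have [k1 k2 k3] := alb r r01.
  split; rewrite /V /=.
    rewrite !mul0r subr0 addr0; apply: Nd => //; try by apply/andP; split; lra.
    by rewrite ger0_norm; lra.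
  have -> : be r - 1 * (be r - al r) = al r by ring.
  have -> : al r + 1 * (be r - al r) = be r by ring.
  apply: Nd => //; try by apply/andP; split; lra.
  by rewrite ler0_norm; lra.
- apply: same_rotation_ext H => s _; rewrite /V /cross /al /be /=;
  by congr (read _ _ _ - read _ _ _); ring.
Qed.

(** * Independence of the chart *)

Section Transition.
Variables (W U' : set F) (g g' : F -> R * R) (k k' : R * R -> F).
Variables (q0 : R * R) (r : R) (e : R) (y : Th).
Hypothesis chW : chart W g k.
Hypothesis chU' : chart U' g' k'.
Hypothesis WU' : W `<=` U'.
Hypothesis k_ball : forall v, `|q0 - v| < r ->
  [/\ U' (k v), g (k v) = v & {for v, continuous k}].
Hypothesis W_ball : forall q, W q -> `|q0 - g q| < r / 8.
Hypothesis e_gt0 : 0 < e.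
Hypothesis Wy : stays W (- e) e y.

Let eta := g' \o k.

Let r_gt0 : 0 < r.
Proof.
have : `|q0 - g (f (phi 0 y))| < r / 8 by apply/W_ball/Wy; rewrite oppr_le0 ltW.
by move/(le_lt_trans (normr_ge0 _)); lra.
Qed.

Let W_ball' q : W q -> `|q0 - g q| < r.
Proof. by move/W_ball/lt_trans; apply; move: r_gt0; lra. Qed.

Let eta_continuous v : `|q0 - v| < r -> {for v, continuous eta}.
Proof.
move=> /k_ball[Uk _ kc]; apply: (cvg_comp k g'); first exact: kc.
by case: chU' => _ gc _ _; exact: gc.
Qed.

Let eta_inj v w : `|q0 - v| < r -> `|q0 - w| < r -> eta v = eta w -> v = w.
Proof.
move=> /k_ball[Uv gv _] /k_ball[Uw gw _] E.
by rewrite -gv -gw (chart_inj chU' Uv Uw E).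
Qed.

Let eta_g q : W q -> eta (g q) = g' q.
Proof. by case: chW => _ _ kg _ Wq; rewrite /eta /= kg. Qed.

Let chart' : chart W g' k'.
Proof. by apply: (chart_sub chU') => //; case: chW. Qed.

(** At an end of the time interval both chords are close to a single chord of the arc of [y]. So are
    the interpolated ones, and continuity of [eta] keeps their images at acute angles. *)
Let corner s t : - e <= s <= e -> - e <= t <= e -> s != t ->
  exists2 N : set Th, nbhs y N & forall x x' x'', N x -> N x' -> N x'' ->
    forall th th', angle th (read g x' t - read g x s) ->
      angle th' (read g x'' t - read g x s) -> `|th - th'| < pi / 2 ->
    let d c := eta (read g x s + interp (read g x' t - read g x s)
        (read g x'' t - read g x s) th th' c) - eta (read g x s) in
    forall a b, 0 <= a <= 1 -> 0 <= b <= 1 -> 0 < dot (d a) (d b).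
Proof.
move=> se te st.
set z0 := read g y s; set v := read g y t - z0.
have Ws := Wy se; have Wt := Wy te.
have v0 : v != 0 by exact: (read_neq chW Wy).
have v'0 : eta (z0 + v) - eta z0 != 0.
  rewrite /v [z0 + _]addrC subrK /z0 /read !eta_g//.
  exact: (read_neq chart' Wy).
have [[A B] /= [nA nB] AB] := dot_gt0_near v'0.
have cvd : eta (p.1 + p.2) - eta p.1 @[p --> (z0, v)] --> eta (z0 + v) - eta z0.
  have c1 : p.1 @[p --> (z0, v)] --> z0 by exact: cvg_fst.
  have c2 : p.2 @[p --> (z0, v)] --> v by exact: cvg_snd.
  apply: cvgB.
    apply: (cvg_comp (fun p => p.1 + p.2) eta); first exact: cvgD c1 c2.
    apply: eta_continuous; rewrite /v [z0 + _]addrC subrK; exact: W_ball'.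
  apply: (cvg_comp (fun p => p.1) eta); first exact: c1.
  by apply: eta_continuous; exact: W_ball'.
have [[Z D] /= [nZ nD] ZD] := cvd _ (filterI nA nB).
have [[P Q] /= [nP nQ] PQ] := interp_near v0 nD.
have cr : read g p.2 t - read g p.1 s @[p --> ((y, y) : Th * Th)] --> v.
  have c1 : p.1 @[p --> ((y, y) : Th * Th)] --> y by exact: cvg_fst.
  have c2 : p.2 @[p --> ((y, y) : Th * Th)] --> y by exact: cvg_snd.
  have FF : Filter (nbhs ((y, y) : Th * Th)) by exact: nbhs_filter.
  have ct : t @[p --> ((y, y) : Th * Th)] --> t by exact: cvg_cst.
  have cs : s @[p --> ((y, y) : Th * Th)] --> s by exact: cvg_cst.
  exact: cvgB (cvg_read FF chW Wt ct c2) (cvg_read FF chW Ws cs c1).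
have [[M M'] /= [nM nM'] MM] := cr _ (filterI nP nQ).
have cz : read g x s @[x --> y] --> z0.
  have c1 : x @[x --> y] --> y by exact: cvg_id.
  have cs : s @[_ --> y] --> s by exact: cvg_cst.
  exact: (cvg_read (nbhs_filter y) chW Ws cs c1).
have nZ' := cz _ nZ.
exists (M `&` M' `&` (fun x => Z (read g x s))); first by do ![apply: filterI].
move=> x x' x'' [[Mx _] Zx] [[_ Mx'] _] [[_ Mx''] _] th th' ath ath' tt a b a01 b01.
pose d c := eta (read g x s + interp (read g x' t - read g x s)
  (read g x'' t - read g x s) th th' c) - eta (read g x s).
have [Px' _] := MM (x, x') (conj Mx Mx').
have [_ Qx''] := MM (x, x'') (conj Mx Mx'').
have dC c : 0 <= c <= 1 -> A (d c) /\ B (d c).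
  move=> c01; apply: (ZD (read g x s, _)); split => //=.
  by apply: (PQ (_, _) (conj Px' Qx'')).
by apply: (AB (d a, d b)); split => /=; [exact: (dC a a01).1|exact: (dC b b01).2].
Qed.

(* Interpolating the two chords in polar coordinates deforms one path of chords
   into the other without meeting the arc of x, whatever the chart. *)
Lemma same_side_transition :
  exists2 N : set Th, nbhs y N & forall x x' x'', N x -> N x' -> N x'' ->
    apart (- e) e x x' -> apart (- e) e x x'' ->
    same_side g (- e) e x x' x'' -> same_side g' (- e) e x x' x''.
Proof.
have ee : - e < e by move: e_gt0; lra.
have L : - e <= - e <= e by rewrite lexx ltW.
have Rr : - e <= e <= e by rewrite lexx ltW.
have ne1 : - e != e by rewrite lt_eqF.
have ne2 : e != - e by rewrite gt_eqF.
have [N1 yN1 c1] := corner L Rr ne1.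
have [N2 yN2 c2] := corner Rr L ne2.
have oW : open W by case: chW.
exists (N1 `&` N2 `&` [set x | stays W (- e) e x]).
  by do ![apply: filterI] => //; exact: near_stays.
move=> x x' x'' [[n1 n2] sx] [[n1' n2'] sx'] [[n1'' n2''] sx''] ax' ax''.
move=> [th [th' [[tc ta] [tc' ta'] t0 t1]]].
pose u s := cross g (- e) e x x' s; pose w s := cross g (- e) e x x'' s.
pose z s := read g x (- e + s * (e - - e)).
pose d (p : R * R) := interp (u p.1) (w p.1) (th p.1) (th' p.1) p.2.
(* The interpolated chord is carried to the other chart by its end points, so injectivity of [eta]
   replaces any derivative in showing that it does not vanish. *)
pose V (p : R * R) := eta (z p.1 + d p) - eta (z p.1).
have in1 s : 0 <= s <= 1 -> - e <= - e + s * (e - - e) <= e.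
  by move=> /andP[s0 s1]; apply/andP; split; nra.
have in2 s : 0 <= s <= 1 -> - e <= e - s * (e - - e) <= e.
  by move=> /andP[s0 s1]; apply/andP; split; nra.
have zb s : 0 <= s <= 1 -> `|q0 - z s| < r / 8 by move=> /in1/sx/W_ball.
(* Points of [W] lie within [r / 8] of [q0], so a chord has maximum norm below [r / 4] and euclidean
   length below [r / 2]; its interpolated tip then stays in the ball of radius [r]. *)
have lenb x1 s : stays W (- e) e x1 -> 0 <= s <= 1 ->
    len (cross g (- e) e x x1 s) < r / 2.
  move=> s1 s01; apply: le_lt_trans (len_le_norm _) _.
  have H1 := zb s s01; have H2 := W_ball (s1 _ (in2 s s01)).
  have : `|cross g (- e) e x x1 s| < r / 8 + r / 8.
    rewrite /cross; apply: le_lt_trans (ler_distD q0 _ _) _.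
    by apply: ltrD => //; rewrite distrC.
  lra.
have nu := cross_nonvanishing chW (ltW ee) sx sx' ax'.
have nw := cross_nonvanishing chW (ltW ee) sx sx'' ax''.
have db p : usquare p -> `|q0 - (z p.1 + d p)| < r.
  move=> /usquareP[p1 p2].
  have H1 : `|d p| < r / 2 by apply: interp_norm => //; exact: lenb.
  have H2 := zb _ p1; rewrite opprD addrA.
  by apply: le_lt_trans (ler_normB _ _) _; move: r_gt0; lra.
have zb' p : usquare p -> `|q0 - z p.1| < r.
  by move=> /usquareP[p1 _]; have := zb _ p1; move: r_gt0; lra.
have d0 p : usquare p -> d p != 0.
  by move=> /usquareP[p1 p2]; apply: interp_neq0 => //; [exact: (nu _ p1).2|exact: (nw _ p1).2].
have V0 p : usquare p -> V p != 0.
  move=> pu; apply: contra (d0 p pu); rewrite subr_eq0 => /eqP/eta_inj E.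
  have /eqP := E (db p pu) (zb' p pu).
  by rewrite -subr_eq0 [z _ + _]addrC addrK.
have Vc p : usquare p -> {for p, continuous V}.
  move=> pu; have [p1 p2] := (iffLR (usquareP p) pu).
  have cp1 : q.1 @[q --> p] --> p.1 by exact: cvg_fst.
  have cp2 : q.2 @[q --> p] --> p.2 by exact: cvg_snd.
  have cz : z q.1 @[q --> p] --> z p.1.
    apply: (cvg_comp (fun q => - e + q.1 * (e - - e)) (read g x)).
      by apply: cvgD; [exact: cvg_cst|apply: cvgMl; exact: cp1].
    exact: read_continuous chW (sx _ (in1 _ p1)).
  have cd : d q @[q --> p] --> d p.
    apply: cvg_interp.
    - exact: (cvg_comp _ u cp1 (nu _ p1).1).
    - exact: (cvg_comp _ w cp1 (nw _ p1).1).
    - exact: (cvg_comp _ th cp1 (tc _)).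
    - exact: (cvg_comp _ th' cp1 (tc' _)).
    - exact: cp2.
  apply: cvgB.
    exact: (cvg_comp _ eta (cvgD cz cd) (eta_continuous (db p pu))).
  exact: (cvg_comp _ eta cz (eta_continuous (zb' p pu))).
have [psi pc pa] := rect_lift Vc V0.
have slice (i : R) : continuous (fun s => psi (s, i)).
  move=> s; apply: (cvg_comp (fun s => (s, i)) psi); last exact: pc.
  by apply: cvg_pr; [exact: cvg_id|exact: cvg_cst].
have slice' (i : R) : continuous (fun s => psi (i, s)).
  move=> s; apply: (cvg_comp (fun s => (i, s)) psi); last exact: pc.
  by apply: cvg_pr; [exact: cvg_cst|exact: cvg_id].
have I0 : 0 <= (0 : R) <= 1 by rewrite lexx ler01.
have I1 : 0 <= (1 : R) <= 1 by rewrite lexx ler01.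
have V_0 s : 0 <= s <= 1 -> V (s, 0) = cross g' (- e) e x x' s.
  move=> s01; rewrite /V /d /= interp0; last exact: ta.
  rewrite /u /cross -/(z s) [z s + _]addrC subrK /z /read !eta_g//.
    by apply/sx/in1.
  by apply/sx'/in2.
have V_1 s : 0 <= s <= 1 -> V (s, 1) = cross g' (- e) e x x'' s.
  move=> s01; rewrite /V /d /= interp1; last exact: ta'.
  rewrite /w /cross -/(z s) [z s + _]addrC subrK /z /read !eta_g//.
    by apply/sx/in1.
  by apply/sx''/in2.
have usq a b : 0 <= a <= 1 -> 0 <= b <= 1 -> usquare (a, b).
  by move=> a1 b1; apply/usquareP.
have close i : 0 <= i <= 1 ->
    (forall a, 0 <= a <= 1 -> 0 < dot (V (i, 0)) (V (i, a))) ->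
    `|psi (i, 0) - psi (i, 1)| < pi / 2.
  move=> i01 H; apply: (@close_end _ (fun a => psi (i, 0) - psi (i, a))).
  - by move=> a; apply: cvgB; [exact: cvg_cst|exact: slice'].
  - move=> a; rewrite in_itv/= => a01.
    rewrite -(@angle_dot_gt0 _ _ _ (V (i, 0)) (V (i, a))); first exact: H.
      by apply: pa; exact: usq.
    by apply: pa; exact: usq.
  - by rewrite subrr normr0; have := @pi_gt0 R; lra.
exists (fun s => psi (s, 0)), (fun s => psi (s, 1)); split.
- split; first exact: slice.
  by move=> s s01; rewrite -V_0//; apply: pa; exact: usq.
- split; first exact: slice.
  by move=> s s01; rewrite -V_1//; apply: pa; exact: usq.
- apply: close => // a a01.
  have A0 := ta 0 I0; have A1 := ta' 0 I0.
  have := c1 _ _ _ n1 n1' n1'' (th 0) (th' 0); rewrite /V /d /u /w /z /cross /=.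
  move: A0 A1; rewrite /cross !mul0r subr0 addr0 => A0 A1.
  by move=> /(_ A0 A1 t0); apply.
- apply: close => // a a01.
  have A0 := ta 1 I1; have A1 := ta' 1 I1.
  have := c2 _ _ _ n2 n2' n2'' (th 1) (th' 1); rewrite /V /d /u /w /z /cross /=.
  have E1 : e - 1 * (e - - e) = - e by ring.
  have E2 : - e + 1 * (e - - e) = e by ring.
  move: A0 A1; rewrite /cross E1 E2 => A0 A1.
  by move=> /(_ A0 A1 t1); apply.
Qed.

End Transition.

Hypothesis phi0 : forall x, phi 0 x = x.
Hypothesis phiD : forall s t x, phi (s + t) x = phi s (phi t x).

Lemma phiC s t x : phi s (phi t x) = phi t (phi s x).
Proof. by rewrite -!phiD addrC. Qed.

(** The bound 1 is that of [T_ge1]. Arcs of half length at most [1 / 4] only involve time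
    differences up to [1 / 2], so remote points have disjoint arcs, also after flowing both. *)
Definition remote x x' := forall c, `|c| < 1 -> phi c x' <> x.

Lemma remote_apart x x' c e : 0 < e <= 1 / 4 -> remote x x' ->
  apart (- e) e (phi c x) (phi c x').
Proof.
move=> /andP[e0 e4] xx' s t /andP[s1 s2] /andP[t1 t2].
rewrite -!phiD => E; apply: (xx' (t - s)); first by rewrite ltr_norml; lra.
have -> : t - s = - (s + c) + (t + c) by ring.
by rewrite phiD E -phiD addNr phi0.
Qed.

Lemma same_side_shift g e c x x' x'' :
  same_side g (c - e) (c + e) x x' x'' <->
  same_side g (- e) e (phi c x) (phi c x') (phi c x'').
Proof.
have E z z' s : cross g (c - e) (c + e) z z' s = cross g (- e) e (phi c z) (phi c z') s.
  rewrite /cross /read -!phiD.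
  by congr (g (f (phi _ _)) - g (f (phi _ _))); ring.
by split; apply: same_rotation_ext.
Qed.

Lemma stays_near0 W y : open W -> W (f y) ->
  exists2 e, 0 < e & forall e', e' <= e -> stays W (- e') e' y.
Proof.
move=> oW Wy.
have cf : f (phi s y) @[s --> (0 : R)] --> f (phi 0 y).
  have cs : s @[s --> (0 : R)] --> (0 : R) by exact: cvg_id.
  have cy : y @[_ --> (0 : R)] --> y by exact: cvg_cst.
  exact: cvg_phi cs cy.
have nW : nbhs (f (phi 0 y)) W by apply: open_nbhs_nbhs; split=> //; rewrite phi0.
have /nbhs_ballP[e /= e0 be] := cf _ nW.
exists (e / 2); first by rewrite divr_gt0.
move=> e' ee' s /andP[s1 s2]; apply: be.
by rewrite -ball_normE /= sub0r normrN ltr_norml; apply/andP; split; lra.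
Qed.

(** Three moves: shrink the interval to a short one around [c] in the first chart, change the chart
    over that short arc, and enlarge the interval in the second chart. *)
Lemma same_side_compare U g k U' g' k' y e e' :
  chart U g k -> chart U' g' k' -> 0 < e <= 1 / 4 -> 0 < e' <= 1 / 4 ->
  stays U (- e) e y -> stays U' (- e') e' y ->
  exists2 N : set Th, nbhs y N & exists2 eta : R, 0 < eta &
    forall x x' x'' c, N x -> N x' -> N x'' -> `|c| < eta ->
      remote x x' -> remote x x'' ->
      same_side g (- e) e x x' x'' ->
      same_side g' (- e') e' (phi c x) (phi c x') (phi c x'').
Proof.
move=> ch ch' /andP[e0 e4] /andP[e'0 e'4] Uy U'y.
have Ufy : U (f y) by rewrite -[y]phi0; apply: Uy; rewrite oppr_le0 ltW.
have U'fy : U' (f y) by rewrite -[y]phi0; apply: U'y; rewrite oppr_le0 ltW.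
have [oU gc kg gk] := ch; have [oU' _ _ _] := ch'.
set q0 := g (f y).
have [r r0 kball] : exists2 r, 0 < r & forall v, `|q0 - v| < r ->
    [/\ U (k v), U' (k v), g (k v) = v & {for v, continuous k}].
  have kc : {for q0, continuous k} by have [] := nbhs_singleton (gk _ Ufy).
  have nU' : nbhs (k q0) U' by rewrite kg//; exact: open_nbhs_nbhs.
  have nn : nbhs q0 [set v | [/\ U (k v), g (k v) = v & {for v, continuous k}] /\
      U' (k v)] by apply: filterI; [exact: gk|exact: kc].
  have /nbhs_ballP[r /= r0 br] := nn.
  exists r => // v vr.
  have [|[? ? ?] ?] := br v; first by rewrite -ball_normE.
  by split.
pose W : set F := [set q | U q /\ `|q0 - g q| < r / 8].
have oW : open W.
  rewrite openE => q [Uq qr]; apply: filterI; first exact: open_nbhs_nbhs.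
  have : `|q0 - g q'| @[q' --> q] --> `|q0 - g q|.
    by apply: cvg_norm; apply: cvgB; [exact: cvg_cst|exact: gc].
  by move/cvgr_lt; apply.
have Wr q : W q -> `|q0 - g q| < r by move=> [_ /lt_trans]; apply; lra.
have WU : W `<=` U by move=> q [].
have WU' : W `<=` U'.
  by move=> q Wq; have [_ + _ _] := kball _ (Wr q Wq); rewrite kg//; exact: WU.
have Wfy : W (f y) by split=> //; rewrite subrr normr0; lra.
have [e1 e10 We1] := stays_near0 oW Wfy.
(* With [d] at most [e / 2], the interval of radius [d] about [c] stays within [[- e, e]] as soon as
   [c] is smaller than [d]. *)
pose d := Num.min e1 (Num.min (e / 2) (e' / 2)).
have d0 : 0 < d by rewrite !lt_min e10 !divr_gt0.
have de1 : d <= e1 by rewrite ge_min lexx.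
have de : d <= e / 2 by rewrite !ge_min lexx orbT.
have de' : d <= e' / 2 by rewrite !ge_min lexx !orbT.
have chW := chart_sub ch oW WU.
have kball' v : `|q0 - v| < r -> [/\ U' (k v), g (k v) = v & {for v, continuous k}].
  by move=> /kball[].
have Wball q : W q -> `|q0 - g q| < r / 8 by case.
have [N1 yN1 H1] := same_side_interval ch Uy d0.
have [N2 yN2 H2] := same_side_transition chW ch' WU' kball' Wball d0 (We1 _ de1).
have [N3 yN3 H3] := same_side_interval ch' U'y d0.
have cphi : phi p.1 p.2 @[p --> ((0, y) : R * Th)] --> phi 0 y.
  exact: (@phi_continuous (0, y)).
rewrite phi0 in cphi.
have [[A B] /= [nA nB] AB] := cphi _ (filterI yN2 yN3).
have /nbhs_ballP[a /= a0 ba] := nA.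
exists (N1 `&` B); first exact: filterI.
exists (Num.min a d); first by rewrite lt_min a0.
move=> x x' x'' c [n1 b1] [n1' b1'] [n1'' b1'']; rewrite lt_min => /andP[ca cd] rx' rx''.
have Ac : A c by apply: ba; rewrite -ball_normE /= sub0r normrN.
have [m2 m3] := AB (c, x) (conj Ac b1).
have [m2' m3'] := AB (c, x') (conj Ac b1').
have [m2'' m3''] := AB (c, x'') (conj Ac b1'').
have ap0 z z' b : 0 < b <= 1 / 4 -> remote z z' -> apart (- b) b z z'.
  by move=> b4 zz'; rewrite -[z]phi0 -[z']phi0; exact: remote_apart.
have e04 : 0 < e <= 1 / 4 by rewrite e0.
have e'04 : 0 < e' <= 1 / 4 by rewrite e'0.
have d04 : 0 < d <= 1 / 4 by rewrite d0/=; lra.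
move: cd; rewrite ltr_norml => /andP[c1 c2] ss.
apply: (H3 _ _ _ m3 m3' m3'' _ _ (- d) d); try lra.
- exact: remote_apart.
- exact: remote_apart.
apply: (H2 _ _ _ m2 m2' m2'').
- exact: remote_apart.
- exact: remote_apart.
apply/same_side_shift.
apply: (H1 _ _ _ n1 n1' n1'' (ap0 _ _ _ e04 rx') (ap0 _ _ _ e04 rx'') (- e) e) => //=; lra.
Qed.

(** * Transport along the flow by compactness *)

Hypothesis Th_compact : compact [set: Th].
Hypothesis Th_hausdorff : hausdorff_space Th.
Hypothesis F_charts : forall p : F, exists U (g : F -> R * R) k, chart U g k /\ U p.
Variable T : nat -> R.
Hypothesis T_ge1 : forall n, 1 <= T n.
Hypothesis T_return : forall (y : Th) (N : set Th), nbhs y N -> exists2 M : set Th, nbhs y M &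
  exists n0 : nat, forall n x (m : int), (n0 <= n)%N -> M x -> N (phi (m%:~R * T n) x).

Definition uniformly (P : nat -> R -> Prop) := exists n0 : nat, exists2 eta : R,
  0 < eta & forall n c, (n0 <= n)%N -> `|c| < eta -> P n c.

Lemma uniformly_all (I : eqType) (s : seq I) (P : I -> nat -> R -> Prop) :
  (forall i, i \in s -> uniformly (P i)) ->
  uniformly (fun n c => forall i, i \in s -> P i n c).
Proof.
elim: s => [_|i s IH H]; first by exists 0%N, 1.
have [n0 [e e0 H0]] := H i (mem_head _ _).
have [|n1 [e' e'0 H1]] := IH; first by move=> j js; apply: H; rewrite inE js orbT.
exists (maxn n0 n1), (Num.min e e'); first by rewrite lt_min e0.
move=> n c; rewrite geq_max lt_min => /andP[h0 h1] /andP[c0 c1] j.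
by rewrite inE => /orP[/eqP ->|js]; [exact: H0|exact: H1].
Qed.

Lemma compact_uniformly (P : Th -> nat -> R -> Prop) :
  (forall y : Th, exists2 M : set Th, nbhs y M &
    uniformly (fun n c => forall x, M x -> P x n c)) ->
  uniformly (fun n c => forall x, P x n c).
Proof.
move=> H.
pose E : set_system (nat * R) := filter_prod \oo (nbhs (0 : R)).
have FE : Filter E by exact: filter_prod_filter.
have /compact_near_coveringP cT := Th_compact.
have K := @cT _ E (fun i x => P x i.1 i.2) FE.
have [|[A B] /= [[n0 _ An] /nbhs_ballP[e /= e0 eB]] AB] := K.
  move=> y _; have [M yM [n0 [e e0 HM]]] := H y.
  exists (M, [set i | (n0 <= i.1)%N /\ `|i.2| < e]); last first.
    by move=> [x [n c]] /= [Mx [nn cc]]; exact: HM.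
  split => //=; exists ([set n | (n0 <= n)%N], ball 0 e) => /=.
    by split; [exists n0|exact: nbhsx_ballx].
  by move=> [n c] /= [nn]; rewrite -ball_normE /= sub0r normrN.
exists n0, e => // n c nn cc x.
apply: (AB (n, c)) => //; split => /=; first exact: An.
by apply: eB; rewrite -ball_normE /= sub0r normrN.
Qed.

Lemma compact_finite_cover (C : Th -> set Th) : (forall y, nbhs y (C y)) ->
  exists s : seq Th, forall x, exists2 y, y \in s & C y x.
Proof.
move=> yC.
(* The filter of all sufficiently large finite sequences turns near-covering compactness into a
   finite subcover. *)
pose E : set_system (seq Th) :=
  [set A | exists s0 : seq Th, forall s : seq Th, {subset s0 <= s} -> A s].
have FE : Filter E.
  split; first by exists [::].
    move=> A B [a Aa] [b Bb]; exists (a ++ b) => s abs.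
    by split; [apply: Aa|apply: Bb] => i is_; apply: abs; rewrite mem_cat is_// orbT.
  by move=> A B AB [a Aa]; exists a => s /Aa/AB.
have /compact_near_coveringP cT := Th_compact.
have K := @cT _ E (fun s x => exists2 y, y \in s & C y x) FE.
have [|s Hs] := K.
  move=> y _; exists (C y, [set s : seq Th | y \in s]); last first.
    by move=> [x s] /= [Cx ys]; exists y.
  by split => //=; exists [:: y] => s; apply; exact: mem_head.
by exists s => x; exact: Hs.
Qed.

Record patch := Patch {
  patch_dom : set F; patch_coord : F -> R * R; patch_inv : R * R -> F;
  patch_radius : R; patch_core : set Th }.

(** Asking this on the closure of the core leaves two cases at each point: either the arc there
    stays in the chart and local comparison applies, or a neighbourhood misses the core and nothing
    is to be shown. *)
Definition good_patch d := [/\ chart (patch_dom d) (patch_coord d) (patch_inv d),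
  0 < patch_radius d <= 1 / 4 &
  forall x, closure (patch_core d) x -> stays (patch_dom d) (- patch_radius d) (patch_radius d) x].

Definition patch_side d n (m m' : int) x := same_side (patch_coord d) (- patch_radius d) (patch_radius d)
  x (phi (m%:~R * T n) x) (phi (m'%:~R * T n) x).

Lemma patch_exists U g k e y : chart U g k -> 0 < e <= 1 / 4 ->
  stays U (- e) e y ->
  exists2 C, nbhs y C & good_patch (Patch U g k e C).
Proof.
move=> ch e4 Uy; have oU : open U by case: ch.
have [C yC CU] := @compact_regular _ y setT Th_hausdorff Th_compact filterT
  _ (near_stays oU Uy).
by exists C => //; split.
Qed.

Lemma remote_return n (m : int) x : m != 0 -> remote x (phi (m%:~R * T n) x).
Proof.
move=> m0 c c1; rewrite -phiD -[RHS]phi0 => /phi_aperiodic/eqP.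
rewrite addr_eq0 => /eqP E; move: c1; rewrite E normrN normrM.
have : 1 <= `|m%:~R : R| by rewrite -intr_norm -[1]/(1%:~R) ler_int norm_intr_ge1 ?intr_int.
by have := T_ge1 n; move=> t1 m1; rewrite (ger0_norm (le_trans ler01 t1)); nra.
Qed.

Lemma patch_step d d' : good_patch d -> good_patch d' ->
  uniformly (fun n c => forall x, patch_core d x -> patch_core d' (phi c x) ->
    forall m m' : int, m != 0 -> m' != 0 ->
    patch_side d n m m' x -> patch_side d' n m m' (phi c x)).
Proof.
move=> [ch e4 cl] [ch' e'4 cl'].
apply: (compact_uniformly (P := fun x n c => patch_core d x -> patch_core d' (phi c x) ->
    forall m m' : int, m != 0 -> m' != 0 ->
    patch_side d n m m' x -> patch_side d' n m m' (phi c x))) => y.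
have [cy|/existsNP[A /existsNP[yA Ad]]] := pselect (closure (patch_core d) y); last first.
  exists A => //; exists 0%N, 1 => // n c _ _ x Ax dx.
  by case: Ad; exists x.
have [c'y|/existsNP[A /existsNP[yA Ad]]] := pselect (closure (patch_core d') y); last first.
  have cphi : phi p.1 p.2 @[p --> ((0, y) : R * Th)] --> phi 0 y.
    exact: (@phi_continuous (0, y)).
  rewrite phi0 in cphi.
  have [[B M] /= [/nbhs_ballP[e /= e0 eB] yM] BM] := cphi _ yA.
  exists M => //; exists 0%N, e => // n c _ ce x Mx _ d'x.
  case: Ad; exists (phi c x); split=> //; apply: (BM (c, x)); split=> //=.
  by apply: eB; rewrite -ball_normE /= sub0r normrN.
have [N yN [eta eta0 HN]] := same_side_compare ch ch' e4 e'4 (cl _ cy) (cl' _ c'y).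
have [M yM [n0 HM]] := T_return yN.
exists (N `&` M); first exact: filterI.
exists n0, eta => // n c nn cc x [Nx Mx] _ _ m m' m0 m'0.
rewrite /patch_side [phi (m%:~R * T n) (phi c x)]phiC [phi (m'%:~R * T n) (phi c x)]phiC.
by apply: HN => //; do ?[exact: HM|exact: remote_return].
Qed.

(** The flow time to [z] is cut into steps shorter than [eta], and [patch_step] is applied at each
    one. The thresholds hold for all pairs from a finite list of patches, so the number of steps is
    free to depend on [n]. *)
Lemma same_side_transport x0 U g k e : chart U g k -> 0 < e <= 1 / 4 ->
  stays U (- e) e x0 -> exists n0 : nat, forall n (m m' : int) (j : nat), (n0 <= n)%N ->
    m != 0 -> m' != 0 ->
    same_side g (- e) e x0 (phi (m%:~R * T n) x0) (phi (m'%:~R * T n) x0) ->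
    let z := phi (j%:~R * T n) x0 in
    same_side g (- e) e z (phi (m%:~R * T n) z) (phi (m'%:~R * T n) z).
Proof.
move=> ch e4 Ux0; have [C0 yC0 gC0] := patch_exists ch e4 Ux0.
pose base := Patch U g k e C0.
(* The patch at [x0] is prescribed, so that the walk starts and ends in the given chart with the
   given [e]. *)
have : forall y, exists d, [/\ good_patch d, nbhs y (patch_core d) & y = x0 -> d = base].
  move=> y; have [->|yx0] := eqVneq y x0; first by exists base.
  have [V [h [l [chV Vy]]]] := F_charts (f y).
  have oV : open V by case: chV.
  have [e1 e10 He1] := stays_near0 oV Vy.
  pose e2 := Num.min e1 (1 / 4).
  have e24 : 0 < e2 <= 1 / 4 by rewrite lt_min e10 divr_gt0//= ge_min lexx orbT.
  have e21 : e2 <= e1 by rewrite ge_min lexx.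
  have [C yC gC] := patch_exists chV e24 (He1 _ e21).
  by exists (Patch V h l e2 C); split => // E; rewrite E eqxx in yx0.
move=> /choice[d_ d_P].
have gd y : good_patch (d_ y) by case: (d_P y).
have d0 : d_ x0 = base by case: (d_P x0) => _ _; exact.
have [|D Dcov] := @compact_finite_cover (fun y => patch_core (d_ y)).
  by move=> y; case: (d_P y).
pose s : seq Th := x0 :: D.
have [n0 [eta eta0 H]] := @uniformly_all _ [seq (i, j) | i <- s, j <- s] _
  (fun ij _ => patch_step (gd ij.1) (gd ij.2)).
have [M yM [n1 HM]] := T_return yC0.
exists (maxn n0 n1) => n m m' j; rewrite geq_max => /andP[nn0 nn1] m0 m'0 ss z.
have step i i' c x : i \in s -> i' \in s -> `|c| < eta ->
    patch_core (d_ i) x -> patch_core (d_ i') (phi c x) ->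
    patch_side (d_ i) n m m' x -> patch_side (d_ i') n m m' (phi c x).
  move=> is_ is' ce xi xi'; apply: (H n c nn0 ce (i, i')) => //.
  by apply/allpairsP; exists (i, i').
pose t : R := j%:~R * T n.
have t0 : 0 <= t by rewrite mulr_ge0// ?ler0z// (le_trans ler01).
pose K := (Num.truncn (t / eta)).+1.
have K0 : 0 < K%:R :> R by rewrite ltr0n.
have cK : `|t / K%:R| < eta.
  rewrite ger0_norm ?divr_ge0// ?(ltW K0)// ltr_pdivrMr// mulrC -ltr_pdivrMr//.
  exact: truncnS_gt.
have walk l : exists2 i, i \in s & patch_core (d_ i) (phi (l%:R * (t / K%:R)) x0) /\
    patch_side (d_ i) n m m' (phi (l%:R * (t / K%:R)) x0).
  elim: l => [|l [i is_ [ci si]]].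
    exists x0; first exact: mem_head.
    rewrite mul0r phi0 d0; split; last exact: ss.
    exact: nbhs_singleton yC0.
  have -> : l.+1%:R * (t / K%:R) = t / K%:R + l%:R * (t / K%:R).
    by rewrite -natr1 mulrDl mul1r addrC.
  rewrite phiD; set x := phi (l%:R * _) x0 in ci si *.
  have [i' i'D ci'] := Dcov (phi (t / K%:R) x).
  have i's : i' \in s by rewrite inE i'D orbT.
  by exists i' => //; split => //; exact: (step i).
have [i is_ [ci si]] := walk K.
have E : K%:R * (t / K%:R) = t by rewrite mulrC divfK// gt_eqF.
rewrite E -/z in ci si.
(* As a multiple of an almost period, the total time brings [x0] back to its core; a last step of
   length 0 then returns to the base patch. *)
have zC : patch_core (d_ x0) (phi 0 z).
  rewrite phi0 d0 /=; apply: (HM n x0 j nn1); exact: nbhs_singleton.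
have := step i x0 0 z is_ (mem_head _ _) _ ci zC si.
by rewrite normr0 phi0 d0; apply.
Qed.

(** Seen from [f x0], the rest of the image in [U] leaves free a cone of half angle [pi / 4] about
    [v]. This is all that is kept of a touching disc. *)
Definition touching U (g : F -> R * R) (x0 : Th) := exists2 v : R * R, v != 0 &
  forall x, U (f x) -> x <> x0 ->
    dot v (g (f x) - g (f x0)) < cos (pi / 4) * (len v * len (g (f x) - g (f x0))).

(** The arc of [x0] is contracted to its centre, which keeps the end chords under control. The
    chords then all start at [f x0] and avoid the free cone, so [cone_same_rotation] applies. *)
Lemma touching_same_side U g k e x0 : chart U g k -> 0 < e <= 1 / 4 ->
  stays U (- e) e x0 -> touching U g x0 ->
  exists2 N : set Th, nbhs x0 N & forall x x', N x -> N x' ->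
    remote x0 x -> remote x0 x' -> same_side g (- e) e x0 x x'.
Proof.
move=> ch /andP[e0 e4] Ux0 [v v0 vcone].
have [N yN Nd] := near_dots ch Ux0 e0.
have oU : open U by case: ch.
exists (N `&` [set x | stays U (- e) e x]).
  by apply: filterI => //; exact: near_stays.
have Nx0 := nbhs_singleton yN.
move=> x x' [nx sx] [nx' sx'] rx rx'.
pose t s := e - s * (e - - e); pose l s := - e + s * (e - - e).
pose V z (p : R * R) := read g z (t p.1) - read g x0 (p.2 * l p.1).
have tin s : 0 <= s <= 1 -> - e <= t s <= e.
  by move=> /andP[s0 s1]; apply/andP; rewrite /t; split; nra.
have lin s r : 0 <= s <= 1 -> 0 <= r <= 1 -> - e <= r * l s <= e.
  move=> /andP[s0 s1] /andP[r0 r1].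
  have [l1 l2] : - e <= l s /\ l s <= e by rewrite /l; split; nra.
  by move: (l s) l1 l2 => y l1 l2; apply/andP; split; nra.
have ap z : remote x0 z -> apart (- e) e x0 z.
  by move=> rz; rewrite -[x0]phi0 -[z]phi0; apply: remote_apart; rewrite ?e0.
have V_ok z : stays U (- e) e z -> remote x0 z ->
    forall p, usquare p -> {for p, continuous (V z)} /\ V z p != 0.
  move=> sz /ap az p /usquareP[p1 p2]; split.
    have c1 : q.1 @[q --> p] --> p.1 by exact: cvg_fst.
    have c2 : q.2 @[q --> p] --> p.2 by exact: cvg_snd.
    have ct : t q.1 @[q --> p] --> t p.1.
      by apply: cvgB; [exact: cvg_cst|apply: cvgMl; exact: c1].
    have cl : q.2 * l q.1 @[q --> p] --> p.2 * l p.1.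
      apply: cvgM; first exact: c2.
      by apply: cvgD; [exact: cvg_cst|apply: cvgMl; exact: c1].
    apply: cvgB.
      exact: (cvg_comp _ (read g z) ct (read_continuous ch (sz _ (tin _ p1)))).
    exact: (cvg_comp _ (read g x0) cl (read_continuous ch (Ux0 _ (lin _ _ p1 p2)))).
  apply/negP; rewrite subr_eq0 => /eqP E.
  apply: (az _ _ (lin _ _ p1 p2) (tin _ p1)); apply/f_inj/(chart_inj ch) => //.
    exact/sz/tin.
  exact/Ux0/lin.
have I0 : 0 <= (0 : R) <= 1 by rewrite lexx ler01.
have I1 : 0 <= (1 : R) <= 1 by rewrite lexx ler01.
have ends r : 0 <= r <= 1 ->
    0 < dot (V x (0, r)) (V x' (0, r)) /\ 0 < dot (V x (1, r)) (V x' (1, r)).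
  move=> r01; have /andP[r0 r1] := r01.
  split; apply: Nd => //; do ?[exact: tin|exact: lin]; rewrite /= /t /l.
    by rewrite ger0_norm; nra.
  by rewrite ler0_norm; nra.
have := @same_rotation_homotopy R (V x) (V x') (V_ok _ sx rx) (V_ok _ sx' rx') ends _.
move=> H; apply: same_rotation_ext (H _) => [s _|s _|].
- by rewrite /V /cross /t /l /= mul1r.
- by rewrite /V /cross /t /l /= mul1r.
have nonv z : stays U (- e) e z -> remote x0 z -> nonvanishing (fun s => V z (s, 0)).
  move=> sz rz s s01; have us : usquare (s, 0) by apply/usquareP.
  have [cV V0] := V_ok z sz rz _ us; split=> //.
  apply: (cvg_comp (fun s => (s, 0)) (V z)); last exact: cV.
  by apply: cvg_pr; [exact: cvg_id|exact: cvg_cst].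
have cone z : stays U (- e) e z -> remote x0 z -> forall s, 0 <= s <= 1 ->
    dot v (V z (s, 0)) < cos (pi / 4) * (len v * len (V z (s, 0))).
  move=> sz rz s s01; rewrite /V /= mul0r /read phi0; apply: vcone.
    exact/sz/tin.
  rewrite -[x0 in _ <> x0]phi0; apply: (ap z rz) => //; last exact: tin.
  by rewrite oppr_le0 ltW.
apply: (cone_same_rotation v0); do ?[exact: nonv|exact: cone].
- exact: (ends 0 I0).1.
- exact: (ends 0 I0).2.
Qed.

Lemma no_touching U g k x0 : chart U g k -> U (f x0) -> ~ touching U g x0.
Proof.
move=> ch Ux0 tch; have oU : open U by case: ch.
have [e1 e10 He1] := stays_near0 oU Ux0.
pose e := Num.min e1 (1 / 4).
have e4 : 0 < e <= 1 / 4 by rewrite lt_min e10 divr_gt0//= ge_min lexx orbT.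
have /andP[e0 _] := e4.
have ee1 : e <= e1 by rewrite ge_min lexx.
have sx0 := He1 _ ee1.
have [N1 yN1 H1] := touching_same_side ch e4 sx0 tch.
have [n0 H2] := same_side_transport ch e4 sx0.
have [N3 yN3 H3] := near_dots ch sx0 e0.
have [M yM [n1 HM]] := T_return (filterI (filterI yN1 yN3) (near_stays oU sx0)).
pose n := maxn n0 n1.
have nn0 : (n0 <= n)%N by rewrite leq_maxl.
have nn1 : (n1 <= n)%N by rewrite leq_maxr.
pose X (m : int) := phi (m%:~R * T n) x0.
have XN m : (N1 `&` N3 `&` [set x | stays U (- e) e x]) (X m).
  by apply: HM => //; exact: nbhs_singleton.
have XD (m m' : int) : phi (m%:~R * T n) (X m') = X (m + m').
  by rewrite /X -phiD -mulrDl intrD.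
have X0 : X 0 = x0 by rewrite /X mul0r phi0.
have base (m m' : int) : m != 0 -> m' != 0 -> same_side g (- e) e x0 (X m) (X m').
  move=> m0 m'0; have [[? _] _] := XN m; have [[? _] _] := XN m'.
  by apply: H1 => //; exact: remote_return.
(* Negative multiples are needed here: from [X 1] and [X 2] the point [X 0] lies backwards along the
   flow. *)
have tr (j : nat) (m m' : int) : m != 0 -> m' != 0 ->
    same_side g (- e) e (X j) (X (m + j)) (X (m' + j)).
  move=> m0 m'0; have := H2 n m m' j nn0 m0 m'0 (base _ _ m0 m'0).
  by rewrite /= -/(X j) !XD.
pose u i j := cross g (- e) e (X i) (X j).
have revu i j s : 0 <= s <= 1 -> u j i s = rev_path (u i j) s.
  move=> _; rewrite /rev_path /u /cross opprB.
  by congr (read _ _ _ - read _ _ _); ring.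
have I0 : 0 <= (0 : R) <= 1 by rewrite lexx ler01.
have dots i j i' j' : 0 < dot (u i j 0) (u i' j' 0).
  rewrite /u /cross !mul0r subr0 addr0.
  have [[? ?] _] := XN i; have [[? ?] _] := XN j.
  have [[? ?] _] := XN i'; have [[? ?] _] := XN j'.
  by apply: H3 => //; do ?[by apply/andP; split; lra]; rewrite ger0_norm; lra.
apply: (@no_three_same_rotations R (u 0 1) (u 0 2) (u 1 2)).
- by rewrite -!revu//; split; split => //; split.
- by have := base 1 2 isT isT; rewrite /same_side -X0.
- have := tr 1%N (-1) 1 isT isT; rewrite /same_side.
  apply: same_rotation_ext => s s01; last by [].
  by rewrite -revu.
- have := tr 2%N (-2) (-1) isT isT; rewrite /same_side.
  by apply: same_rotation_ext => s s01; rewrite -revu.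
Qed.

End Charts.

(** * A disc touching the image *)

Section Touching.
Variables (R : realType) (F Th : topologicalType) (f : Th -> F).
Hypothesis F_hausdorff : hausdorff_space F.
Hypothesis f_continuous : continuous f.
Hypothesis f_inj : injective f.
Hypothesis f_inv : forall (x : Th) (N : set Th), nbhs x N ->
  \forall q \near f x, forall x', f x' = q -> N x'.
Hypothesis Th_compact : compact [set: Th].
Hypothesis no_disc : forall (i : R * R -> Th) (c : R * R) (rho : R), 0 < rho ->
  (forall v, `|c - v| < rho -> {for v, continuous i}) ->
  (forall v v', `|c - v| < rho -> `|c - v'| < rho -> i v = i v' -> v = v') -> False.

(* A closest point of the image to a nearby point outside it: a disc centred
   there touches the image only at that point. *)
Lemma touching_exists (U : set F) (g : F -> R * R) k y : chart U g k -> U (f y) ->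
  exists x0 W, [/\ chart W g k, W (f x0) & touching f W g x0].
Proof.
move=> ch Uy; have [oU gc kg gk] := ch.
set q0 := g (f y).
have /nbhs_ballP[r /= r0 br] := gk _ Uy.
have r8 : r / 8 < r by lra.
have kball v : `|q0 - v| < r -> [/\ U (k v), g (k v) = v & {for v, continuous k}].
  by move=> vr; apply: br; rewrite -ball_normE.
(* Otherwise the image would contain the whole disc, and inverting [f] on it would give an injective
   continuous disc in [Th]. *)
have [z zr znf] : exists2 z, `|q0 - z| < r / 8 & forall x, f x <> k z.
  apply: contrapT => H.
  have ex v : exists x, `|q0 - v| < r / 8 -> f x = k v.
    have [vr|nvr] := pselect (`|q0 - v| < r / 8); last by exists y => /nvr.
    apply: contrapT => H'; apply: H; exists v => // x E; apply: H'; by exists x.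
  have [i iP] := choice ex.
  apply: (@no_disc i q0 (r / 8)); first by rewrite divr_gt0.
    move=> v vr N /= nN.
    have := f_inv nN; rewrite (iP v vr) => nq.
    have [_ _ kc] := kball v (lt_trans vr r8).
    have nb : \forall v' \near v, `|q0 - v'| < r / 8.
      have : `|q0 - v'| @[v' --> v] --> `|q0 - v|.
        by apply: cvg_norm; apply: cvgB; [exact: cvg_cst|exact: cvg_id].
      by move/cvgr_lt; apply.
    have nk : \forall v' \near v, forall x', f x' = k v' -> N x' by exact: (kc _ nq).
    suff : \forall v' \near v, N (i v') by [].
    near=> v'.
    have vr' : `|q0 - v'| < r / 8 by near: v'; exact: nb.
    have Nv' : forall x', f x' = k v' -> N x' by near: v'; exact: nk.
    by apply: Nv'; exact: iP.
  move=> v v' vr vr' E.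
  have [_ <- _] := kball v (lt_trans vr r8).
  have [_ <- _] := kball v' (lt_trans vr' r8).
  by rewrite -(iP v vr) -(iP v' vr') E.
(* The radius leaves room for the points of [W] below: their distance to [q0] is less than
   [r / 8 + r / 4 + r / 4]. *)
pose S : set (R * R) := `[q0.1 - 3 / 4 * r, q0.1 + 3 / 4 * r] `*`
  `[q0.2 - 3 / 4 * r, q0.2 + 3 / 4 * r].
have SP v : S v <-> `|q0 - v| <= 3 / 4 * r.
  rewrite prod_normE /= ge_max /S /= !in_itv/= -!ler_distlC.
  by split=> [[-> ->]//|/andP[]].
have kS v : S v -> [/\ U (k v), g (k v) = v & {for v, continuous k}].
  by move/SP => vr; apply: kball; apply: le_lt_trans vr _; lra.
have cS : compact S by apply: compact_setX; exact: segment_compact.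
have clK : closed (k @` S).
  apply: compact_closed => //; apply: continuous_compact => //.
  by apply: continuous_in_subspaceT => v /set_mem/kS[].
pose K : set Th := f @^-1` (k @` S).
have cK : compact K.
  apply: (subclosed_compact _ Th_compact) => //.
  by apply: preimage_closed => // x _; exact: f_continuous.
have KU x : K x -> U (f x) by move=> [v Sv <-]; case: (kS v Sv).
have Ky : K y.
  exists q0; last by rewrite kg.
  by apply/SP; rewrite subrr normr0; lra.
have cD : {within K, continuous (fun x => len (z - g (f x)))}.
  apply: continuous_in_subspaceT => x /set_mem/KU Ux.
  apply: cvg_len; apply: cvgB; first exact: cvg_cst.
  by apply: (cvg_comp f g); [exact: f_continuous|exact: gc].
have [|x0 /set_mem Kx0 x0min] := @compact_EVT_min _ _ _ K _ cK cD.
  by exists y.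
have Ux0 := KU _ Kx0.
set q1 := g (f x0); pose v := z - q1.
have v0 : v != 0.
  rewrite subr_eq0; apply/eqP => zq; apply: (znf x0).
  by rewrite zq /q1 kg.
have lv : len v <= r / 4.
  have H1 := x0min y (mem_set Ky).
  have H2 := len_le_norm (z - q0).
  have H3 : `|z - q0| < r / 8 by rewrite distrC.
  by apply: le_trans H1 _; apply: le_trans H2 _; lra.
set ka := cos (pi / 4 : R).
have ka0 : 0 < ka.
  by apply: cos_gt0_pihalf; have := @pi_gt0 R; lra.
have ka1 : ka <= 1 by exact: cos_le1.
have lv0 : 0 < len v by rewrite len_gt0.
(* In this radius minimality gives [2 * dot v d <= len d ^+ 2 < ka * len v * len d], so the cosine
   of the angle with [v] is even below [ka / 2]. *)
pose W : set F := [set q | U q /\ len (g q - q1) < ka * len v].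
have oW : open W.
  rewrite openE => q [Uq ql]; apply: filterI; first exact: open_nbhs_nbhs.
  have : len (g q' - q1) @[q' --> q] --> len (g q - q1).
    by apply: cvg_len; apply: cvgB; [exact: gc|exact: cvg_cst].
  by move/cvgr_lt; apply.
exists x0, W; split.
- by apply: (chart_sub ch oW) => q [].
- split=> //; rewrite /q1 subrr.
  have -> : len (0 : R * R) = 0 by rewrite /len /dot/= mul0r addr0 sqrtr0.
  exact: mulr_gt0.
exists v => // x [Ux dlt] xx0; rewrite -/q1; set d := g (f x) - q1 in dlt *.
have d0 : 0 < len d.
  rewrite len_gt0 subr_eq0; apply/eqP => E; apply: xx0.
  by apply: f_inj; apply: (chart_inj ch).
have Kx : K x.
  exists (g (f x)); last by rewrite kg.
  apply/SP.
  have -> : q0 - g (f x) = (q0 - z) + v - d.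
    by rewrite /v /d opprB !subrKA.
  apply: le_trans (ler_normB _ _) _; apply: le_trans (lerD (ler_normD _ _) (lexx _)) _.
  have := norm_le_len v; have := norm_le_len d.
  have : ka * len v <= len v by rewrite ler_piMl// ltW.
  lra.
have := x0min x (mem_set Kx); rewrite -/q1 -/v.
have -> : z - g (f x) = v - d by rewrite /v /d opprB subrKA.
move=> Hmin.
have H2 : dot v v <= dot (v - d) (v - d).
  by rewrite -!len2 ler_sqr ?nnegrE ?len_ge0.
have H3 : 2 * dot v d <= len d ^+ 2.
  by rewrite len2; move: H2; rewrite /dot/=; lra.
have H4 : len d ^+ 2 < ka * len v * len d.
  by rewrite expr2 ltr_pM2r.
have : 0 < ka * len v * len d by rewrite !mulr_gt0.
by rewrite mulrA -/ka; lra.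
Unshelve. all: by end_near. Qed.

End Touching.

(** * Pointwise forms of surfaces and embeddings *)

Section SurfaceCharts.
Variables (R : realType) (F : topologicalType).

Lemma cvg_initial (S : choiceType) (X : topologicalType) (w : S -> X) (T : Type)
    (E : set_system T) (FE : Filter E) (h : T -> initial_topology w)
    (a : initial_topology w) :
  w (h z) @[z --> E] --> w a -> h z @[z --> E] --> a.
Proof.
move=> cw U [? /= [[W oW <-]]] /= Wa /filterS; apply; apply: cw.
exact: open_nbhs_nbhs.
Qed.

Lemma val_continuous (X : topologicalType) (A : set X) : continuous (set_val : A -> X).
Proof. exact: initial_continuous. Qed.

Lemma homeo_chart (U : set F) (V : set (R * R)) (h : U -> V) (p : F) :
  open U -> open V -> homeomorphism h -> U p ->
  exists g k, @chart R F U g k.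
Proof.
move=> oU oV [hc [l [hl lh lc]]] Up.
pose p' : U := exist _ p (mem_set Up).
(* Extends the inverse of [set_val] by a default value; on an open [A] this does not affect
   continuity at points of [A]. *)
pose lift_ (X : topologicalType) (A : set X) (a : A) (x : X) : A :=
  if pselect (A x) is left Ax then exist _ x (mem_set Ax) else a.
have liftE (X : topologicalType) (A : set X) (a : A) x : A x -> set_val (lift_ X A a x) = x.
  by move=> Ax; rewrite /lift_; case: pselect.
have liftc (X : topologicalType) (A : set X) (a : A) x : open A -> A x ->
    {for x, continuous (lift_ X A a)}.
  move=> oA Ax; apply: cvg_initial.
  rewrite liftE//; apply: cvg_trans (@cvg_id _ (nbhs x)).
  apply: near_eq_cvg; near=> x'; rewrite liftE//.
  by near: x'; exact: open_nbhs_nbhs.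
have liftK (X : topologicalType) (A : set X) (a b : A) : lift_ X A a (set_val b) = b.
  by apply/val_inj/liftE/set_valP.
pose g q := set_val (h (lift_ F U p' q)).
pose k v := set_val (l (lift_ _ V (h p') v)).
exists g, k; split=> //.
- move=> q Uq.
  apply: (cvg_comp (lift_ F U p') (fun x => set_val (h x)) (liftc F U p' q oU Uq)).
  by apply: (cvg_comp h set_val); [exact: hc|exact: val_continuous].
- by move=> q Uq; rewrite /k /g liftK hl liftE.
move=> q Uq.
have Vg : V (g q) by exact: set_valP.
near=> v.
have Vv : V v by near: v; exact: open_nbhs_nbhs.
split.
- exact: set_valP.
- by rewrite /g /k liftK lh liftE.
apply: (cvg_comp (lift_ _ V (h p')) (fun x => set_val (l x)) (liftc _ V (h p') v oV Vv)).
by apply: (cvg_comp l set_val); [exact: lc|exact: val_continuous].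
Unshelve. all: by end_near. Qed.

Lemma surface_charts : surface R F ->
  forall p : F, exists U (g : F -> R * R) k, chart U g k /\ U p.
Proof.
move=> [_ _ loc] p; have [U [V [h [oU Up oV hh]]]] := loc p.
by have [g [k ch]] := homeo_chart oU oV hh Up; exists U, g, k.
Qed.

Lemma embedding_continuous (X : topologicalType) (f : X -> F) :
  embedding f -> continuous f.
Proof.
move=> [tc _] x.
exact: (cvg_comp (to_range f) set_val (tc x) (@val_continuous _ _ (to_range f x))).
Qed.

Lemma embedding_inj (X : topologicalType) (f : X -> F) : embedding f -> injective f.
Proof.
move=> [_ [l [fl _ _]]] x x' E; apply: (can_inj fl).
exact: val_inj.
Qed.

Lemma embedding_inv (X : topologicalType) (f : X -> F) (x : X) (N : set X) :
  embedding f -> nbhs x N -> \forall q \near f x, forall x', f x' = q -> N x'.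
Proof.
move=> [_ [l [fl _ lc]]] nN.
have nN' : nbhs (l (to_range f x)) N by rewrite fl.
have [A [[B oB <-] /= Bfx BN]] := lc _ _ nN'.
near=> q => x' E.
have Bq : B q by near: q; exact: open_nbhs_nbhs.
have := BN (to_range f x'); rewrite /= fl; apply.
suff : B (f x') by [].
by rewrite E.
Unshelve. all: by end_near. Qed.

End SurfaceCharts.

(** * No disc injects continuously into the line *)

Section NoDisc.
Variable R : realType.

(* Of three non-collinear points, the one with the middle value would share it
   with a point of the segment joining the other two. *)
Lemma no_injection_disc_line (t : R * R -> R) (c : R * R) (rho : R) : 0 < rho ->
  (forall v, `|c - v| < rho -> {for v, continuous t}) ->
  (forall v v', `|c - v| < rho -> `|c - v'| < rho -> t v = t v' -> v = v') -> False.
Proof.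
move=> rho0 tc tinj.
pose pt (a b : R) : R * R := (c.1 + a * (rho / 2), c.2 + b * (rho / 2)).
have ptb a b : 0 <= a <= 1 -> 0 <= b <= 1 -> `|c - pt a b| < rho.
  move=> /andP[a0 a1] /andP[b0 b1]; rewrite prod_normE /= gt_max.
  have aux x y : 0 <= x -> x <= 1 -> `|y - (y + x * (rho / 2))| < rho.
    move=> x0 x1; have -> : y - (y + x * (rho / 2)) = - (x * (rho / 2)) by ring.
    by rewrite normrN ger0_norm; nra.
  by rewrite !aux.
have mid (a b a1 b1 a2 b2 : R) : 0 <= a <= 1 -> 0 <= b <= 1 ->
    0 <= a1 <= 1 -> 0 <= b1 <= 1 -> 0 <= a2 <= 1 -> 0 <= b2 <= 1 ->
    (forall s, 0 <= s <= 1 -> a1 + s * (a2 - a1) <> a \/ b1 + s * (b2 - b1) <> b) ->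
    t (pt a1 b1) <= t (pt a b) <= t (pt a2 b2) -> False.
  move=> a01 b01 a101 b101 a201 b201 off /andP[m1 m2].
  pose q s := pt (a1 + s * (a2 - a1)) (b1 + s * (b2 - b1)).
  have qb s : 0 <= s <= 1 -> `|c - q s| < rho.
    move=> /andP[s0 s1]; apply: ptb; apply/andP; split; nra.
  have qc : continuous q.
    have aff (x d : R) : continuous (fun s : R => x + s * d).
      by move=> s; apply: cvgD; [exact: cvg_cst|apply: cvgMl; exact: cvg_id].
    move=> s; apply: cvg_pr; (apply: cvgD; first exact: cvg_cst);
      by apply: cvgMl; exact: aff.
  have [||s s01 E] := @IVT R (t \o q) 0 1 (t (pt a b)) ler01.
  - apply: continuous_in_subspaceT => s /set_mem; rewrite /= in_itv/= => s01.
    by apply: (cvg_comp q t); [exact: qc|exact: tc (qb s s01)].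
  - have -> : (t \o q) 0 = t (pt a1 b1) by rewrite /q /= !mul0r !addr0.
    have -> : (t \o q) 1 = t (pt a2 b2) by rewrite /q /= !mul1r ![_ + (_ - _)]addrC !subrK.
    by rewrite ge_min m1/= le_max m2 orbT.
  rewrite in_itv/= in s01.
  have := tinj _ _ (qb s s01) (ptb _ _ a01 b01) E.
  rewrite /q /pt => -[] /addrI E1 /addrI E2.
  have r2 : rho / 2 != 0 by rewrite gt_eqF// divr_gt0.
  by case: (off s s01); [move/mulIf: E1 => /(_ r2)|move/mulIf: E2 => /(_ r2)].
have I0 : 0 <= (0 : R) <= 1 by rewrite lexx ler01.
have I1 : 0 <= (1 : R) <= 1 by rewrite lexx ler01.
have H0 : forall s : R, 0 <= s <= 1 -> 1 + s * (0 - 1) <> 0 \/ 0 + s * (1 - 0) <> 0.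
  move=> s _; have [->|/eqP s0] := eqVneq s 0; first by left; lra.
  by right; lra.
have H0' : forall s : R, 0 <= s <= 1 -> 0 + s * (1 - 0) <> 0 \/ 1 + s * (0 - 1) <> 0.
  by move=> s /H0[]; [right|left].
have H1 : forall s : R, 0 <= s <= 1 -> 0 + s * (0 - 0) <> 1 \/ 0 + s * (1 - 0) <> 0.
  by move=> s _; left; lra.
have H1' : forall s : R, 0 <= s <= 1 -> 0 + s * (0 - 0) <> 1 \/ 1 + s * (0 - 1) <> 0.
  by move=> s _; left; lra.
have H2 : forall s : R, 0 <= s <= 1 -> 0 + s * (1 - 0) <> 0 \/ 0 + s * (0 - 0) <> 1.
  by move=> s _; right; lra.
have H2' : forall s : R, 0 <= s <= 1 -> 1 + s * (0 - 1) <> 0 \/ 0 + s * (0 - 0) <> 1.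
  by move=> s _; right; lra.
have M0 := mid 0 0 1 0 0 1 I0 I0 I1 I0 I0 I1 H0.
have M0' := mid 0 0 0 1 1 0 I0 I0 I0 I1 I1 I0 H0'.
have M1 := mid 1 0 0 0 0 1 I1 I0 I0 I0 I0 I1 H1.
have M1' := mid 1 0 0 1 0 0 I1 I0 I0 I1 I0 I0 H1'.
have M2 := mid 0 1 0 0 1 0 I0 I1 I0 I0 I1 I0 H2.
have M2' := mid 0 1 1 0 0 0 I0 I1 I1 I0 I0 I0 H2'.
have [h1|/ltW h1] := leP (t (pt 0 0)) (t (pt 1 0));
have [h2|/ltW h2] := leP (t (pt 0 0)) (t (pt 0 1));
have [h3|/ltW h3] := leP (t (pt 1 0)) (t (pt 0 1)).
- by apply: M1; rewrite h1.
- by apply: M2; rewrite h2.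
- by apply: M0'; rewrite h2.
- by apply: M0'; rewrite h2.
- by apply: M0; rewrite h1.
- by apply: M0; rewrite h1.
- by apply: M2'; rewrite h3.
- by apply: M1'; rewrite h3.
Qed.

End NoDisc.

(** * The solenoid and its flow *)

Section Cis.
Variable R : realType.

Definition vec (z : R[i]) : R * R := (complex.Re z, complex.Im z).

Definition cis (t : R) : R[i] := (cos t +i* sin t)%C.

Lemma vec_inj : injective vec.
Proof. by move=> [a b] [c d] [-> ->]. Qed.

Lemma vecB (z z' : R[i]) : vec (z - z') = vec z - vec z'.
Proof. by case: z; case: z'. Qed.

Lemma normC_len (z : R[i]) : `|z| = (len (vec z))%:C%C.
Proof. by rewrite normc_def /len /dot /vec /= -!expr2. Qed.

Lemma len_circle (z : R[i]) : `|z| = 1 -> len (vec z) = 1.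
Proof. by rewrite normC_len => /(congr1 (@complex.Re R)). Qed.

Lemma angle_cisP (z : R[i]) t : `|z| = 1 -> angle t (vec z) <-> z = cis t.
Proof.
move=> /len_circle z1; split=> [[_ zt]|->].
  by apply: vec_inj; rewrite zt z1 /polar !mul1r.
have -> : vec (cis t) = polar 1 t by rewrite /polar !mul1r.
exact: angle_polar.
Qed.

Lemma cisD s t : cis (s + t) = cis s * cis t.
Proof. by apply: vec_inj; rewrite /vec /cis /= cosD sinD; congr (_, _); ring. Qed.

Lemma cis0 : cis 0 = 1.
Proof. by apply: vec_inj; rewrite /vec /cis /= cos0 sin0. Qed.

Lemma norm_cis t : `|cis t| = 1.
Proof.
have E : vec (cis t) = polar 1 t by rewrite /polar !mul1r.
by rewrite normC_len E len_polar.
Qed.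

Lemma cisX t k : cis t ^+ k = cis (k%:R * t).
Proof.
elim: k => [|k IH]; first by rewrite expr0 mul0r cis0.
by rewrite exprS IH -cisD -natr1 mulrDl mul1r addrC.
Qed.

Lemma cisN t : cis t = 1 -> cis (- t) = 1.
Proof. by move=> t1; rewrite -[LHS]mul1r -{1}t1 -cisD subrr cis0. Qed.

Lemma cis_2pi (m : int) : cis (2 * pi * m%:~R) = 1.
Proof.
have c1 : cis (2 * pi) = 1.
  by apply: vec_inj; rewrite /vec /cis /= mulr_natl cos2pi sin2pi.
case: m => k; first by rewrite mulrC -cisX c1 expr1n.
by rewrite NegzE rmorphN mulrN; apply: cisN; rewrite mulrC -cisX c1 expr1n.
Qed.

(** The modulus is the euclidean length, which defines the same topology as the maximum norm of the
    product. *)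
Lemma cvg_vecP (T : Type) (E : set_system T) (FE : Filter E) (h : T -> R[i]^o)
    (a : R[i]^o) :
  h z @[z --> E] --> a <-> vec (h z) @[z --> E] --> vec a.
Proof.
split=> ha.
  apply/cvgrPdist_lt => e e0.
  have e0' : 0 < e%:C%C :> R[i] by rewrite ltcR.
  move: ha => /cvgr_dist_lt/(_ _ e0').
  apply: filterS => z; rewrite normC_len ltcR vecB.
  exact: le_lt_trans (norm_le_len _).
apply/cvgrPdist_lt => e; rewrite ltcE /= => /andP[/eqP e0 e1].
have Ee : e = (complex.Re e)%:C%C by case: e e0 e1 => x y /= ->.
have C : len (vec a - vec (h z)) @[z --> E] --> (0 : R).
  have -> : 0 = len (vec a - vec a).
    by rewrite subrr /len /dot/= mul0r addr0 sqrtr0.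
  by apply: cvg_len; apply: cvgB => //; exact: cvg_cst.
move: C => /cvgr_lt/(_ _ e1).
by apply: filterS => z; rewrite Ee normC_len ltcR vecB.
Qed.

Lemma cis_continuous : continuous (cis : R -> R[i]^o).
Proof.
move=> t; apply/cvg_vecP; apply: cvg_pr; [exact: continuous_cos|exact: continuous_sin].
Qed.

Lemma cvg_mulC (T : Type) (E : set_system T) (FE : Filter E) (h l : T -> R[i]^o)
    (a b : R[i]^o) : h z @[z --> E] --> a -> l z @[z --> E] --> b ->
  ((h z : R[i]) * l z : R[i]^o) @[z --> E] --> ((a : R[i]) * b : R[i]^o).
Proof.
move=> /cvg_vecP ha /cvg_vecP lb; apply/cvg_vecP.
have vM (x y : R[i]) : vec (x * y) = ((vec x).1 * (vec y).1 - (vec x).2 * (vec y).2,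
    (vec x).1 * (vec y).2 + (vec x).2 * (vec y).1) by case: x; case: y.
under eq_fun do rewrite vM.
rewrite vM; apply: cvg_pr.
  by apply: cvgB; apply: cvgM; do ?[exact: cvg_fst_of|exact: cvg_snd_of].
by apply: cvgD; apply: cvgM; do ?[exact: cvg_fst_of|exact: cvg_snd_of].
Qed.

Lemma cvg_expC (T : Type) (E : set_system T) (FE : Filter E) (h : T -> R[i]^o)
    (a : R[i]^o) k : h z @[z --> E] --> a ->
  ((h z : R[i]) ^+ k : R[i]^o) @[z --> E] --> ((a : R[i]) ^+ k : R[i]^o).
Proof.
move=> ha; elim: k => [|k IH].
  by under eq_fun do rewrite expr0; rewrite expr0; exact: cvg_cst.
by under eq_fun do rewrite exprS; rewrite exprS; exact: cvg_mulC.
Qed.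

Lemma compact_set_type (X : topologicalType) (A : set X) :
  compact A -> compact [set: A].
Proof.
move=> cA E PE _.
have [|a [Aa clE]] := cA (set_val @ E) _.
  by apply: (@filterS _ E _ setT) => [x _|]; [exact: set_valP|exact: filterT].
exists (exist _ a (mem_set Aa)); split=> // P N EP [? [[B oB <-] /= Ba] BN].
have EP' : (set_val @ E) (set_val @` P).
  by apply: (@filterS _ E _ P _ _ EP) => x Px; exists x.
have nB : nbhs a B by exact: open_nbhs_nbhs.
have [_ [[x Px <-] Bx]] := clE _ _ EP' nB.
by exists x; split=> //; exact: BN.
Qed.

Lemma circle_compact : compact [set: circle R].
Proof.
apply: compact_set_type.
have -> : circle R = cis @` `[0, 2 * pi]%classic.
  apply/seteqP; split=> [z z1|_ [t _ <-]]; last exact: norm_cis.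
  have z0 : vec z != 0 by rewrite -len_gt0 len_circle.
  have [t tz] := angle_exists z0.
  have [x x2 cx] := angle_mod t.
  exists x; first by rewrite /= in_itv.
  have := angle_shift cx tz.
  by rewrite subKr => /(angle_cisP x z1).
apply: continuous_compact; last exact: segment_compact.
by apply: continuous_in_subspaceT => t _; exact: cis_continuous.
Qed.

End Cis.

(** * Topology, flow and almost periods of the solenoid *)

Section Solenoid.
Variables (R : realType) (w : nat -> nat).
Hypothesis hw : forall n, (1 <= n)%N -> (1 < w n)%N.
Local Notation Th := (solenoid R w).

Definition coord (x : Th) (n : nat) : R[i]^o := set_val (set_val x n).

Lemma norm_coord (x : Th) n : `|coord x n : R[i]| = 1.
Proof. exact: (set_valP (set_val x n)). Qed.

Lemma coord_inj (x y : Th) : (forall n, coord x n = coord y n) -> x = y.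
Proof. by move=> xy; apply/val_inj/functional_extensionality_dep => n; exact/val_inj/xy. Qed.

Lemma coordS (x : Th) n : coord x n = (coord x n.+1 : R[i]) ^+ w n.+1.
Proof. by rewrite /coord [set_val x n](set_valP x n.+1 isT). Qed.

Definition period n : nat := \prod_(1 <= i < n.+1) w i.

Lemma periodS n : period n.+1 = (period n * w n.+1)%N.
Proof. by rewrite /period big_nat_recr. Qed.

Lemma period_gt n : (n < period n)%N.
Proof.
elim: n => [|n IH]; first by rewrite /period big_geq.
have w1 := hw (ltn0Sn n); rewrite periodS.
have p0 := leq_ltn_trans (leq0n n) IH; apply: leq_ltn_trans IH _.
by rewrite -[X in (X < _)%N]muln1 ltn_mul2l w1 andbT.
Qed.

Lemma period_gt0 n : (0 < period n)%N.
Proof. exact: leq_ltn_trans (period_gt n). Qed.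

Lemma period_dvd m n : (m <= n)%N -> (period m %| period n)%N.
Proof.
elim: n => [|n IH]; first by rewrite leqn0 => /eqP ->.
rewrite leq_eqVlt => /orP[/eqP -> //|mn].
by rewrite periodS dvdn_mulr// IH.
Qed.

Lemma coord0 (x : Th) n : coord x 0 = (coord x n : R[i]) ^+ period n.
Proof.
elim: n => [|n IH]; first by rewrite /period big_geq// expr1.
by rewrite IH coordS -exprM periodS mulnC.
Qed.

Lemma cvg_coord (T : Type) (E : set_system T) (FE : Filter E) (h : T -> Th) (a : Th) :
  (forall n, coord (h z) n @[z --> E] --> coord a n) -> h z @[z --> E] --> a.
Proof.
move=> ha; apply: cvg_initial; apply/cvg_sup => n.
by apply: cvg_initial; apply: cvg_initial; exact: ha.
Qed.

Lemma prod_coord_continuous n : continuous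
  (fun x : prod_topology (fun _ : nat => circle R) => set_val (x n) : R[i]^o).
Proof.
move=> x.
exact: (cvg_comp (fun x : prod_topology (fun _ : nat => circle R) => x n) set_val
  (@proj_continuous _ (fun _ => circle R) n x) (@val_continuous _ _ _)).
Qed.

Lemma coord_continuous n : continuous (coord^~ n).
Proof.
move=> x; exact: (cvg_comp set_val _ (@val_continuous _ _ x) (@prod_coord_continuous n _)).
Qed.

Lemma solenoid_closed : closed (solenoid R w).
Proof.
pose D n (x : prod_topology (fun _ : nat => circle R)) : R[i]^o :=
  (set_val (x n) : R[i]^o) - ((set_val (x n.+1) : R[i]) ^+ w n.+1 : R[i]^o).
have -> : solenoid R w = \bigcap_n (D n @^-1` [set 0]).
  apply/seteqP; split=> [x sx n _|x sx [//|n] _].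
    by rewrite /D /= [x n](sx n.+1 isT) subrr.
  by apply/val_inj/eqP; rewrite -subr_eq0; apply/eqP; exact: (sx n).
apply: closed_bigI => n _; apply: preimage_closed; last first.
  by apply: accessible_closed_set1; apply: hausdorff_accessible; exact: norm_hausdorff.
move=> x _; have c1 := @prod_coord_continuous n x.
have c2 := cvg_expC (k := w n.+1) (nbhs_filter x) (@prod_coord_continuous n.+1 x).
exact: (cvgB c1 c2).
Qed.

Lemma solenoid_compact : compact [set: Th].
Proof.
apply: compact_set_type.
have cP := @tychonoff nat (fun _ => circle R) (fun _ => setT) (fun _ => @circle_compact R).
have cT : compact [set: prod_topology (fun _ : nat => circle R)].
  by apply: (subclosed_compact _ cP) => //; exact: closedT.
exact: (subclosed_compact solenoid_closed cT).
Qed.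

Lemma solenoid_hausdorff : hausdorff_space Th.
Proof.
move=> x y xy; apply: coord_inj => n.
apply: (@norm_hausdorff _ R[i]^o) => A B nA nB.
have [z [Az Bz]] := xy _ _ (coord_continuous nA) (coord_continuous nB).
by exists (coord z n).
Qed.

Lemma solenoid_point : exists x : Th, True.
Proof.
have c1 : circle R 1 by rewrite /circle /= normr1.
pose o : circle R := exist _ (1 : R[i]^o) (mem_set c1).
suff so : solenoid R w (fun=> o) by exists (exist (fun x => x \in solenoid R w) _ (mem_set so)).
by move=> n _; apply: val_inj => /=; rewrite expr1n.
Qed.

Definition speed (t : R) n : R := 2 * pi * t / (period n)%:R.

Lemma period_neq0 n : (period n)%:R != 0 :> R.
Proof. by rewrite pnatr_eq0 -lt0n period_gt0. Qed.

Lemma flow_circle t (x : Th) n : circle R ((coord x n : R[i]) * cis (speed t n)).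
Proof. by rewrite /circle /= normrM norm_coord norm_cis mulr1. Qed.

Definition flow_prod t (x : Th) : prod_topology (fun _ : nat => circle R) :=
  fun n => exist _ ((coord x n : R[i]) * cis (speed t n) : R[i]^o)
    (mem_set (flow_circle t x n)).

Lemma flow_solenoid t x : solenoid R w (flow_prod t x).
Proof.
move=> [//|n] _; apply: val_inj => /=.
rewrite exprMn cisX -coordS; congr (_ * cis _).
rewrite /speed periodS natrM; have := period_neq0 n.
have : (w n.+1)%:R != 0 :> R by rewrite pnatr_eq0 -lt0n ltnW// hw.
by move=> ? ?; field; apply/andP.
Qed.

Definition flow t (x : Th) : Th :=
  exist _ (flow_prod t x) (mem_set (flow_solenoid t x)).

Lemma coord_flow t x n : coord (flow t x) n = (coord x n : R[i]) * cis (speed t n).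
Proof. by []. Qed.

Lemma flow0 x : flow 0 x = x.
Proof. by apply: coord_inj => n; rewrite coord_flow /speed mulr0 mul0r cis0 mulr1. Qed.

Lemma flowD s t x : flow (s + t) x = flow s (flow t x).
Proof.
apply: coord_inj => n; rewrite !coord_flow -mulrA -cisD; congr (_ * cis _).
by rewrite /speed; ring.
Qed.

Lemma flow_continuous : continuous (fun p : R * Th => flow p.1 p.2).
Proof.
move=> p; apply: cvg_coord => n.
have c1 : coord q.2 n @[q --> p] --> coord p.2 n.
  by apply: (cvg_comp snd (coord^~ n)); [exact: cvg_snd|exact: coord_continuous].
have c2 : speed q.1 n @[q --> p] --> speed p.1 n.
  by apply: cvgMl; apply: cvgMr; exact: cvg_fst.
have c3 := cvg_comp _ (@cis R : R -> R[i]^o) c2 (@cis_continuous _ _).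
exact: (cvg_mulC (nbhs_filter p) c1 c3).
Qed.

(** The [n]-th coordinate returns only at multiples of [period n], and some [period n] exceeds the
    distance between [s] and [t]. *)
Lemma flow_aperiodic s t x : flow s x = flow t x -> s = t.
Proof.
move=> E.
pose n := Num.truncn `|s - t|.
have W0 : 0 < (period n)%:R :> R by rewrite ltr0n period_gt0.
have stn : `|s - t| < (period n)%:R.
  apply: lt_le_trans (truncnS_gt _) _; rewrite ler_nat; exact: period_gt.
have /(congr1 (coord^~ n)) := E; rewrite !coord_flow.
have cn0 : (coord x n : R[i]) != 0 by rewrite -normr_eq0 norm_coord oner_eq0.
move=> /(mulfI cn0) cst.
have c1 : cis (speed s n - speed t n) = 1.
  by rewrite cisD cst -cisD subrr cis0.
have c1' : cos (speed s n - speed t n) = 1 by move: (congr1 (@complex.Re R) c1).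
have E0 : speed s n - speed t n = 2 * pi * ((s - t) / (period n)%:R).
  by rewrite /speed; ring.
have pi0 := @pi_gt0 R.
have := cos1_eq0 c1'; rewrite E0 normrM (@ger0_norm _ (2 * pi)) ?mulr_ge0 ?ltW//.
rewrite -[X in _ < X]mulr1 ltr_pM2l ?mulr_gt0// normrM normfV (gtr0_norm W0).
rewrite ltr_pdivrMr// mul1r => /(_ stn) /eqP.
rewrite !mulf_eq0 pnatr_eq0 /= (gt_eqF pi0) invr_eq0 (negbTE (period_neq0 n)) orbF /=.
by rewrite subr_eq0 => /eqP.
Qed.

Lemma period_ge1 n : 1 <= (period n)%:R :> R.
Proof. by rewrite ler1n period_gt0. Qed.

Lemma speed_period (m : int) k n : (k <= n)%N ->
  cis (speed (m%:~R * (period n)%:R) k) = 1.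
Proof.
move=> /period_dvd/dvdnP[d ->].
have -> : speed (m%:~R * (d * period k)%:R) k = 2 * pi * (m * d)%:~R.
  rewrite /speed natrM rmorphM /=; have := period_neq0 k => ?; field.
  by [].
exact: cis_2pi.
Qed.

(** Flowing for a multiple of [period n] fixes all coordinates up to [n], whatever the multiple, and
    a neighbourhood constrains only finitely many coordinates. *)
Lemma flow_return (y : Th) (N : set Th) : nbhs y N -> exists2 M : set Th, nbhs y M &
  exists n0 : nat, forall n x (m : int), (n0 <= n)%N -> M x ->
    N (flow (m%:~R * (period n)%:R) x).
Proof.
move=> nN.
(* Choosing for each pair a multiple that violates the conclusion, if there is one, turns uniformity
   in [m] into one convergence along a filter on pairs. *)
have ex (p : Th * nat) : exists m : int, (exists m', ~ N (flow (m'%:~R * (period p.2)%:R) p.1)) ->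
    ~ N (flow (m%:~R * (period p.2)%:R) p.1).
  have [[m Hm]|H] := pselect (exists m' : int, ~ N (flow (m'%:~R * (period p.2)%:R) p.1)).
    by exists m.
  by exists 0.
have [j jP] := choice ex.
have FE : Filter (filter_prod (nbhs y) (@nbhs nat _ \oo)) by exact: filter_prod_filter.
have c : flow ((j p)%:~R * (period p.2)%:R) p.1 @[p --> filter_prod (nbhs y) \oo] --> y.
  apply: cvg_coord => k.
  have c1 : coord p.1 k @[p --> filter_prod (nbhs y) \oo] --> coord y k.
    by apply: (cvg_comp fst (coord^~ k)); [exact: cvg_fst|exact: coord_continuous].
  apply: cvg_trans c1; apply: near_eq_cvg.
  exists (setT, [set n | (k <= n)%N]) => /=.
    by split; [exact: filterT|exists k].
  by move=> [x n] /= [_ kn]; rewrite coord_flow speed_period// mulr1.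
have [[M L] /= [nM [n0 _ Ln]] ML] := c _ nN.
exists M => //; exists n0 => n x m nn Mx; apply: contrapT => H.
apply: (jP (x, n)); first by exists m.
by apply: (ML (x, n)); split=> //; exact: Ln.
Qed.

End Solenoid.

(** * Discs in the solenoid *)

Section SolenoidNoDisc.
Variables (R : realType) (w : nat -> nat).
Hypothesis hw : forall n, (1 <= n)%N -> (1 < w n)%N.
Local Notation Th := (solenoid R w).
Local Notation flow := (flow hw).

(* Near the centre the first coordinate determines a flow time; flowing back by
   it, all coordinates become roots of a constant, hence constant.  So the disc
   would inject into a flow line. *)
Lemma solenoid_no_disc (i : R * R -> Th) (c : R * R) (rho : R) : 0 < rho ->
  (forall v, `|c - v| < rho -> {for v, continuous i}) ->
  (forall v v', `|c - v| < rho -> `|c - v'| < rho -> i v = i v' -> v = v') -> False.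
Proof.
move=> rho0 ic iinj.
set y := i c.
pose p q := vec (coord (i q) 0).
have pc q : `|c - q| < rho -> {for q, continuous p}.
  move=> /ic iq; have := cvg_comp i (fun x => coord x 0) iq (@coord_continuous R w 0 (i q)).
  by move/cvg_vecP.
have cc : `|c - c| < rho by rewrite subrr normr0.
have p0 : p c != 0.
  by rewrite -len_gt0 len_circle//; exact: norm_coord.
(* On the smaller disc the 0-th coordinate stays within a right angle of its central value, where
   [tau] below is continuous. *)
have [rho' rho'0 [rr dotp]] : exists2 rho', 0 < rho' & rho' <= rho /\
    forall q, `|c - q| < rho' -> 0 < dot (p c) (p q).
  have C : dot (p c) (p q) @[q --> c] --> dot (p c) (p c).
    by apply: cvg_dot; [exact: cvg_cst|exact: pc].
  have d0 : 0 < dot (p c) (p c) by rewrite -len2 exprn_gt0// len_gt0.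
  have N : \forall q \near c, 0 < dot (p c) (p q) by move: C => /cvgr_gt/(_ _ d0).
  have /nbhs_ballP[e /= e0 be] := N.
  exists (Num.min e rho); first by rewrite lt_min e0.
  split; first by rewrite ge_min lexx orbT.
  by move=> q; rewrite lt_min => /andP[qe _]; apply: be; rewrite -ball_normE.
have rb q : `|c - q| < rho' -> `|c - q| < rho by move/lt_le_trans; apply.
have pi0 := @pi_gt0 R.
have [al pal] := angle_exists p0.
(* The flow time that carries the 0-th coordinate of [i c] to that of [i q]; the 0-th coordinate
   turns once per unit of time, hence the factor [2 * pi]. *)
pose tau q := atan (crs (p c) (p q) / dot (p c) (p q)) / (2 * pi).
have tauc q : `|c - q| < rho' -> {for q, continuous tau}.
  move=> qr; apply: cvgMl.
  have cp := pc q (rb q qr).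
  have cpc : p c @[_ --> q] --> p c by exact: cvg_cst.
  apply: (cvg_comp (fun q => crs (p c) (p q) / dot (p c) (p q)) atan); last exact: continuous_atan.
  apply: cvgM; first exact: cvg_crs.
  by apply: cvgV; [rewrite gt_eqF// dotp|exact: cvg_dot].
have tau0 : tau c = 0.
  by rewrite /tau; have -> : crs (p c) (p c) = 0 by [rewrite /crs; ring]; rewrite mul0r atan0 mul0r.
have per0 : period w 0 = 1%N by rewrite /period big_geq.
pose j q := flow (- tau q) (i q).
have j0 q : `|c - q| < rho' -> coord (j q) 0 = coord y 0.
  move=> qr; have := angle_step pal (dotp q qr).
  move=> /(angle_cisP _ (norm_coord _ _)) E1.
  have /(angle_cisP _ (norm_coord _ _)) E2 := pal.
  have E3 : 2 * pi * tau q = atan (crs (p c) (p q) / dot (p c) (p q)).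
    by rewrite /tau mulrC divfK// gt_eqF// mulr_gt0.
  by rewrite coord_flow E1 [RHS]E2 -cisD /speed per0 divr1 mulrN E3 addrK.
have jc q : `|c - q| < rho' -> {for q, continuous j}.
  move=> qr.
  have c1 : ((- tau z, i z) : R * Th) @[z --> q] --> ((- tau q, i q) : R * Th).
    by apply: cvg_pr; [apply: cvgN; exact: tauc|exact/ic/rb].
  exact: (cvg_comp _ (fun p : R * Th => flow p.1 p.2) c1 (@flow_continuous _ _ hw _)).
have jy q : `|c - q| < rho' -> j q = y.
  move=> qr; apply: coord_inj => n.
  pose z (s : R) : R * R := c + s *: (q - c).
  have zr s : 0 <= s <= 1 -> `|c - z s| < rho'.
    move=> /andP[s0 s1]; rewrite /z opprD addrA subrr sub0r normrN normrZ ger0_norm//.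
    by apply: le_lt_trans qr; rewrite distrC ler_piMl.
  have zc : continuous z.
    move=> s; apply: cvgD; first exact: cvg_cst.
    by apply: cvgZl; exact: cvg_id.
  pose g s := vec (coord (j (z s)) n).
  have gn : nonvanishing g.
    move=> s s01; split; last by rewrite -len_gt0 len_circle//; exact: norm_coord.
    have c1 := cvg_comp z j (zc s) (jc _ (zr s s01)).
    by have /cvg_vecP := cvg_comp _ (fun x => coord x n) c1 (@coord_continuous R w n (j (z s))).
  have [t [tc ta]] := path_lift gn.
  have tE s : 0 <= s <= 1 -> coord (j (z s)) n = cis (t s).
    by move=> /ta /(angle_cisP _ (norm_coord _ _)).
  have I0 : 0 <= (0 : R) <= 1 by rewrite lexx ler01.
  have I1 : 0 <= (1 : R) <= 1 by rewrite lexx ler01.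
  pose m : R := (period w n)%:R.
  have mt s : 0 <= s <= 1 -> cis (m * t s) = coord y 0.
    by move=> s01; rewrite -cisX -tE// -(coord0 (j (z s))) j0//; exact: zr.
  (* Along the segment from [c] to [q], [m * t s] is a continuous argument of the constant
     [coord y 0], so it cannot vary. *)
  have h1 : m * t 1 - m * t 0 = 0.
    apply: (@const_end _ (fun s => m * t s - m * t 0)).
    - move=> s; apply: cvgB; last exact: cvg_cst.
      by apply: cvgMr; exact: tc.
    - move=> s; rewrite in_itv/= => s01.
      have : cis (m * t s - m * t 0) = 1.
        by rewrite cisD mt// -(mt 0 I0) -cisD subrr cis0.
      by move/(congr1 (@complex.Re R)).
    - by rewrite subrr.
  have m0 : m != 0 by exact: period_neq0.
  have t10 : t 1 = t 0 by apply: (mulfI m0); lra.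
  have z1 : z 1 = q by rewrite /z scale1r addrC subrK.
  have z0 : z 0 = c by rewrite /z scale0r addr0.
  by rewrite -z1 tE// t10 -tE// z0 /j tau0 oppr0 flow0.
apply: (no_injection_disc_line rho'0 tauc) => q q' qr qr' E.
apply: iinj; [exact: rb|exact: rb|].
have iE v : `|c - v| < rho' -> i v = flow (tau v) y.
  by move=> vr; rewrite -(jy v vr) /j -flowD subrr flow0.
by rewrite !iE// E.
Qed.

End SolenoidNoDisc.

Theorem theorem1 (R : realType) (w : nat -> nat)
    (hw : forall n : nat, (1 <= n)%N -> (1 < w n)%N)
    (F : topologicalType) (hF : surface R F) :
  ~ (exists f : solenoid R w -> F, embedding f).
Proof.
move=> [f fe].
have fc := embedding_continuous fe.
have fi := embedding_inj fe.
have charts := surface_charts hF.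
have Fh : hausdorff_space F by case: hF.
have finv x N := @embedding_inv F _ f x N fe.
have [y _] := solenoid_point R w.
have [U [g [k [ch Uy]]]] := charts (f y).
have [x0 [W [chW Wx0]]] := touching_exists Fh fc fi finv (@solenoid_compact R w)
  (solenoid_no_disc hw) ch Uy.
exact: (no_touching (@flow_continuous R w hw) (@flow_aperiodic R w hw) fc fi
  (flow0 hw) (flowD hw) (@solenoid_compact R w) (@solenoid_hausdorff R w) charts
  (period_ge1 R hw) (@flow_return R w hw) chW Wx0).
Qed.
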